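(* Let $n\ge1$, let $3\le q\le n$ be an integer, let $\Lambda\subseteq\mathbb{Z}/q\mathbb{Z}$ be non-empty, and define $\eta=|\mathrm{supp}\,\mathcal{D}_{q,\Lambda}|\cdot2^{-n}$. Let $f\colon\{0,1\}^m\to\{0,1\}^n$ be a $d$-local function. Then $$\|f(\mathcal{U}^m)-\mathcal{D}_{q,\Lambda}\|\ge 1-\frac{6q}{\eta}\exp\left\{-\frac{n}{q^2\cdot\mathrm{tow}_2(18d)}\right\}-\begin{cases}|\Lambda|/q & q\text{ odd},\\ 2\max\{|\Lambda_{\mathsf{even}}|,|\Lambda_{\mathsf{odd}}|\}/q & q\text{ even}.\end{cases}$$
   Context: $\mathcal{U}^m$ is uniform on $\{0,1\}^m$. $\mathcal{D}_{q,\Lambda}$ is the uniform distribution over $x\in\{0,1\}^n$ with $|x|\bmod q\in\Lambda$, where $|x|$ is the Hamming weight. For even $q$, $\Lambda_{\mathsf{even}}$ and $\Lambda_{\mathsf{odd}}$ are the sets of elements of $\Lambda$ that are even, respectively odd (well defined since $q$ is even). A function is $d$-local if each output bit depends on at most $d$ input bits. $\mathrm{tow}_2(0)=1$, $\mathrm{tow}_2(h)=2^{\mathrm{tow}_2(h-1)}$. $\|\cdot\|$ is total variation distance. *)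

(* Defs.v *)
From mathcomp Require Import all_boot all_order all_algebra.
From mathcomp Require Import reals.
From mathcomp.analysis Require Import sequences exp.
Set Implicit Arguments. Unset Strict Implicit. Unset Printing Implicit Defensive.
Import Order.TTheory GRing.Theory Num.Theory.
Local Open Scope ring_scope.

Definition bits (n : nat) := {ffun 'I_n -> bool}.

Definition hw (n : nat) (x : bits n) : nat := #|[set i | x i]|.

Fixpoint tow2 (h : nat) : nat := if h is h'.+1 then (2 ^ tow2 h')%N else 1%N.

Definition local (m n d : nat) (f : bits m -> bits n) : Prop :=
  forall i : 'I_n, exists S : {set 'I_m}, (#|S| <= d)%N /\
    forall x y : bits m, (forall j, j \in S -> x j = y j) -> f x i = f y i.

Definition inLam (q : nat) (Lam : {set 'I_q}) (w : nat) : bool :=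
  [exists i in Lam, (val i == w %% q)%N].

Definition suppD (n q : nat) (Lam : {set 'I_q}) : {set bits n} :=
  [set x | inLam Lam (hw x)].

Definition pushU {R : realType} (m n : nat) (f : bits m -> bits n) (y : bits n) : R :=
  #|[set x | f x == y]|%:R / (2 ^ m)%:R.

Definition Dq {R : realType} (n q : nat) (Lam : {set 'I_q}) (y : bits n) : R :=
  (if y \in suppD n Lam then 1 else 0) / #|suppD n Lam|%:R.

Definition tvd {R : realType} (T : finType) (P Q : T -> R) : R :=
  2^-1 * \sum_(y : T) `|P y - Q y|.

Definition LamEven (q : nat) (Lam : {set 'I_q}) : {set 'I_q} := [set i in Lam | ~~ odd i].
Definition LamOdd (q : nat) (Lam : {set 'I_q}) : {set 'I_q} := [set i in Lam | odd i].

(* Main.v *)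
(* Remove a set S of high-degree input bits such that, once S is fixed, there are r >>
   |S| output bits (centers) whose neighborhoods, the outputs sharing a remaining
   input with them, have bounded size and are independent for distinct centers. S comes
   from two pigeonhole arguments: first over 2d degree levels separated by four iterated
   exponentials, to find a level that few outputs touch, then over dyadic thresholds
   inside this level.

If, for a restriction of S, half of the neighborhoods have a non-uniform marginal, then
each of them has a constant bias and the restricted distribution is exponentially far
from uniform, by a product of tilted densities; since 2^|S| is small compared with this
gain, one can afford a union bound over the restrictions. Otherwise half of the
neighborhoods are uniform. Then for every q-th root of unity w with w^2 <> 1, resampling
the inputs of the centers shows that E w^|f| is exponentially small, and Fourier
inversion modulo q leaves only the characters 1 and, for even q, -1. These two account
for the main term, |Lam|/q or 2 max(|Lam_even|, |Lam_odd|)/q. *)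
Require Import Defs.
From mathcomp Require Import all_boot all_order all_algebra all_field.
From mathcomp Require Import zify ring lra.
From mathcomp Require Import reals.
From mathcomp.analysis Require Import sequences exp.
Set Implicit Arguments. Unset Strict Implicit. Unset Printing Implicit Defensive.
Import Order.TTheory GRing.Theory Num.Theory.
Local Open Scope ring_scope.

(** * Means over the cube, dependence sets and resampling *)

Definition Ex (F : numFieldType) (m : nat) (g : bits m -> F) : F :=
  (\sum_x g x) / (2 ^ m)%:R.

Definition mix (m : nat) (A : {set 'I_m}) (x y : bits m) : bits m :=
  [ffun i => if i \in A then x i else y i].

Definition dep (m : nat) (T : Type) (A : {set 'I_m}) (g : bits m -> T) : Prop :=
  forall x y : bits m, (forall i, i \in A -> x i = y i) -> g x = g y.

Definition agree (m : nat) (A : {set 'I_m}) (x y : bits m) : bool :=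
  [forall i in A, x i == y i].

Lemma card_bits m : #|{: bits m}| = (2 ^ m)%N.
Proof. by rewrite card_ffun card_bool card_ord. Qed.

Lemma two_expn_neq0 (F : numFieldType) m : (2 ^ m)%:R != 0 :> F.
Proof. by rewrite pnatr_eq0 expn_eq0. Qed.

Lemma eq_Ex (F : numFieldType) m (g h : bits m -> F) : g =1 h -> Ex g = Ex h.
Proof. by move=> e; rewrite /Ex; congr (_ / _); apply: eq_bigr => x _; exact: e. Qed.

Lemma ExD (F : numFieldType) m (g h : bits m -> F) :
  Ex (fun x => g x + h x) = Ex g + Ex h.
Proof. by rewrite /Ex big_split mulrDl. Qed.

Lemma ExZ (F : numFieldType) m c (g : bits m -> F) :
  Ex (fun x => c * g x) = c * Ex g.
Proof. by rewrite /Ex -mulr_sumr mulrA. Qed.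

Lemma ExZr (F : numFieldType) m c (g : bits m -> F) :
  Ex (fun x => g x * c) = Ex g * c.
Proof. by rewrite mulrC -ExZ; apply: eq_Ex => x; rewrite mulrC. Qed.

Lemma Ex_cst (F : numFieldType) m (c : F) : Ex (fun _ : bits m => c) = c.
Proof.
by rewrite /Ex sumr_const card_bits -[c *+ _]mulr_natr mulfK ?two_expn_neq0.
Qed.

Lemma Ex_sum (F : numFieldType) m (I : Type) (r : seq I) (P : pred I)
    (g : I -> bits m -> F) :
  Ex (fun x => \sum_(i <- r | P i) g i x) = \sum_(i <- r | P i) Ex (g i).
Proof. by rewrite /Ex exchange_big mulr_suml. Qed.

Lemma Ex_exchange (F : numFieldType) m k (g : bits m -> bits k -> F) :
  Ex (fun x => Ex (g x)) = Ex (fun y => Ex (fun x => g x y)).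
Proof. by rewrite {3}/Ex /Ex -!mulr_suml exchange_big mulrAC. Qed.

Lemma ler_Ex (F : numFieldType) m (g h : bits m -> F) :
  (forall x, g x <= h x) -> Ex g <= Ex h.
Proof. by move=> le_gh; rewrite ler_wpM2r ?invr_ge0 ?ler0n ?ler_sum. Qed.

Lemma Ex_ge0 (F : numFieldType) m (g : bits m -> F) :
  (forall x, 0 <= g x) -> 0 <= Ex g.
Proof. by move=> g0; rewrite -(Ex_cst m 0) ler_Ex. Qed.

Lemma norm_Ex_le (F : numFieldType) m (g : bits m -> F) :
  `|Ex g| <= Ex (fun x => `|g x|).
Proof.
rewrite /Ex normrM normfV normr_nat ler_wpM2r ?invr_ge0 ?ler0n //.
exact: ler_norm_sum.
Qed.

Lemma Ex_indicator (F : numFieldType) m (A : pred (bits m)) :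
  Ex (fun x => (A x)%:R) = #|[set x | A x]|%:R / (2 ^ m)%:R :> F.
Proof.
rewrite /Ex -sum1_card natr_sum [in RHS]big_mkcond; congr (_ / _).
by apply: eq_bigr => x _; rewrite inE; case: (A x).
Qed.

Lemma mixE m (A : {set 'I_m}) (x y : bits m) i :
  mix A x y i = if i \in A then x i else y i.
Proof. by rewrite ffunE. Qed.

Lemma mixK m (A : {set 'I_m}) (x y : bits m) :
  mix A (mix A x y) (mix A y x) = x.
Proof. by apply/ffunP => i; rewrite !ffunE; case: (i \in A). Qed.

(** Exchanging the coordinates in [A] between two inputs is an involution on pairs, so it preserves
    the uniform measure on pairs. *)
Lemma Ex_mix (F : numFieldType) m (A : {set 'I_m}) (g : bits m -> F) :
  Ex (fun x => Ex (fun y => g (mix A x y))) = Ex g.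
Proof.
rewrite -[in RHS](eq_Ex (fun x => @Ex_cst F m (g x))) /Ex -!mulr_suml; congr (_ / _ / _).
rewrite !pair_bigA /=.
rewrite (reindex_inj (h := fun p => (mix A p.1 p.2, mix A p.2 p.1))) /=; last first.
  apply: (can_inj (g := fun p => (mix A p.1 p.2, mix A p.2 p.1))) => -[x y] /=.
  by rewrite !mixK.
by apply: eq_bigr => p _; rewrite mixK.
Qed.

Lemma dep_sub m T (A B : {set 'I_m}) (g : bits m -> T) :
  dep A g -> A \subset B -> dep B g.
Proof. by move=> dg /subsetP sAB x y e; apply: dg => i /sAB /e. Qed.

Lemma dep_comp m T U (A : {set 'I_m}) (h : T -> U) (g : bits m -> T) :
  dep A g -> dep A (fun x => h (g x)).
Proof. by move=> dg x y e; rewrite (dg x y e). Qed.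

Lemma dep2 m T1 T2 U (A : {set 'I_m}) (h : T1 -> T2 -> U)
    (g1 : bits m -> T1) (g2 : bits m -> T2) :
  dep A g1 -> dep A g2 -> dep A (fun x => h (g1 x) (g2 x)).
Proof. by move=> d1 d2 x y e; rewrite (d1 x y e) (d2 x y e). Qed.

Lemma dep_big m T (op : T -> T -> T) (z : T) I (r : seq I) (P : pred I)
    (A : {set 'I_m}) (g : I -> bits m -> T) :
  (forall i, P i -> dep A (g i)) -> dep A (fun x => \big[op/z]_(i <- r | P i) g i x).
Proof. by move=> dg x y e; apply: eq_bigr => i /dg; apply. Qed.

Lemma dep_mixl m T (A B : {set 'I_m}) (g : bits m -> T) x y :
  dep A g -> A \subset B -> g (mix B x y) = g x.
Proof. by move=> dg /subsetP sAB; apply: dg => i /sAB; rewrite mixE => ->. Qed.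

Lemma dep_mixr m T (A B : {set 'I_m}) (g : bits m -> T) x y :
  dep A g -> [disjoint A & B] -> g (mix B x y) = g y.
Proof.
move=> dg /pred0P dAB; apply: dg => i iA; rewrite mixE; case: ifP => // iB.
by have := dAB i; rewrite /= iA iB.
Qed.

(** Take the coordinates in [A] from [x] and the others from an independent [y]: then [g] reads only
    [x] and [h] only [y]. *)
Lemma Ex_indep (F : numFieldType) m (A B : {set 'I_m}) (g h : bits m -> F) :
  dep A g -> dep B h -> [disjoint A & B] ->
  Ex (fun x => g x * h x) = Ex g * Ex h.
Proof.
move=> dg dh dAB; rewrite -(Ex_mix A) -ExZr; apply: eq_Ex => x.
rewrite -ExZ; apply: eq_Ex => y.
by rewrite (dep_mixl _ _ dg) // (dep_mixr _ _ dh) // disjoint_sym.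
Qed.

Lemma Ex_indep_prod (F : numFieldType) m (I : eqType) (s : seq I)
    (K : I -> {set 'I_m}) (g : I -> bits m -> F) :
  uniq s -> {in s, forall i, dep (K i) (g i)} ->
  {in s &, forall i j, i != j -> [disjoint K i & K j]} ->
  Ex (fun x => \prod_(i <- s) g i x) = \prod_(i <- s) Ex (g i).
Proof.
elim: s => [|i s IH] /=.
  move=> *; rewrite big_nil -[RHS](Ex_cst m); apply: eq_Ex => x.
  by rewrite big_nil.
case/andP=> iNs us dg dK; rewrite big_cons -IH //; first last.
- by move=> j k js ks; apply: dK; rewrite inE ?js ?ks orbT.
- by move=> j js; apply: dg; rewrite inE js orbT.
rewrite -(@Ex_indep _ _ (K i) (~: K i)).
- by apply: eq_Ex => x; rewrite big_cons.
- by apply: dg; rewrite mem_head.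
- move=> x y e; apply: eq_big_seq => j js; apply: (dg j).
    by rewrite inE js orbT.
  move=> k kKj; apply: e; rewrite inE; apply/negP => kKi.
  have /pred0P/(_ k) : [disjoint K i & K j].
    apply: dK; rewrite ?mem_head // ?inE ?js ?orbT //.
    by apply: contraNneq iNs => ->.
  by rewrite /= kKi kKj.
- by rewrite -setI_eq0 setICr.
Qed.

Lemma Ex_prod_coord (F : numFieldType) m (phi : 'I_m -> bool -> F) :
  Ex (fun x => \prod_i phi i (x i)) = \prod_i ((phi i true + phi i false) / 2).
Proof.
rewrite big_split /= prodr_const card_ord exprVn -natrX; congr (_ / _).
by rewrite -bigA_distr_bigA; apply: eq_bigr => i _; rewrite big_bool.
Qed.

Lemma Ex_agree (F : numFieldType) m (A : {set 'I_m}) (z : bits m) :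
  Ex (fun x => (agree A z x)%:R) = (2 ^ #|A|)%:R^-1 :> F.
Proof.
pose phi i (b : bool) : F := if i \in A then (z i == b)%:R else 1.
transitivity (Ex (fun x => \prod_i phi i (x i))).
  apply: eq_Ex => x; case: (boolP (agree A z x)) => [/'forall_in_eqP ag|].
    by rewrite big1 // => i _; rewrite /phi; case: ifP => // /ag ->; rewrite eqxx.
  rewrite negb_forall_in => /exists_inP[i iA ne].
  by rewrite (bigD1 i) //= /phi iA (negPf ne) mul0r.
rewrite Ex_prod_coord natrX -exprVn -prodr_const [RHS]big_mkcond.
apply: eq_bigr => i _; rewrite /phi; case: ifP => _.
  by case: (z i); rewrite ?addr0 ?add0r mul1r.
by rewrite -mulr2n divff // pnatr_eq0.
Qed.

Lemma agree_dep m T (A : {set 'I_m}) (g : bits m -> T) x y :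
  dep A g -> agree A x y -> g x = g y.
Proof. by move=> dg /'forall_in_eqP e; apply: dg. Qed.

Lemma agreeC m (A : {set 'I_m}) (x y : bits m) : agree A x y = agree A y x.
Proof. by apply: eq_forallb => i; rewrite eq_sym. Qed.

Lemma dep_agree m (A : {set 'I_m}) (z : bits m) : dep A (agree A z).
Proof.
by move=> x y e; apply: eq_forallb => i; case: (boolP (i \in A)) => //= /e ->.
Qed.

Lemma dep_Ex_mix (F : numFieldType) m (A K : {set 'I_m}) (g : bits m -> F) :
  dep K g -> dep (K :\: A) (fun x => Ex (fun y => g (mix A y x))).
Proof.
move=> dg x y e; apply: eq_Ex => z; apply: dg => i iK; rewrite !mixE.
by case: ifP => // iA; apply: e; rewrite inE iA.
Qed.

Lemma dep_average (F : numFieldType) m (A : {set 'I_m}) (g : bits m -> F) x :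
  dep A g -> g x = (2 ^ #|A|)%:R * Ex (fun z => g z * (agree A x z)%:R).
Proof.
move=> dg; rewrite -[LHS](mulfVK (two_expn_neq0 F #|A|)) mulrC -(Ex_agree F A x).
congr (_ * _); rewrite -ExZ; apply: eq_Ex => z.
case: (boolP (agree A x z)) => [e|]; last by rewrite !mulr0.
by rewrite (agree_dep dg e).
Qed.

(** * Uniform marginals and granularity of probabilities *)

(** The counts stay in [nat], so that one boolean predicate serves both the complex field of the
    characters and the real field of the overlaps. *)
Definition unif_on (m n : nat) (N : {set 'I_n}) (g : bits m -> bits n) : bool :=
  [forall z, #|[set x | agree N (g x) z]| * 2 ^ #|N| == 2 ^ m]%N.

Lemma Ex_agree_eqE (F : numFieldType) (m n : nat) (N : {set 'I_n})
    (g : bits m -> bits n) z :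
  (Ex (fun x => (agree N (g x) z)%:R) == (2 ^ #|N|)%:R^-1 :> F) =
  (#|[set x | agree N (g x) z]| * 2 ^ #|N| == 2 ^ m)%N.
Proof.
rewrite Ex_indicator -[X in _ == X]mul1r eqr_div ?two_expn_neq0 // mul1r -natrM.
by rewrite eqr_nat.
Qed.

Lemma unif_on_Ex (F : numFieldType) (m n : nat) (N : {set 'I_n})
    (g : bits m -> bits n) (phi : bits n -> F) :
  unif_on N g -> dep N phi -> Ex (fun x => phi (g x)) = Ex phi.
Proof.
move=> /forallP ug dphi; under eq_Ex => x do rewrite (dep_average (g x) dphi).
rewrite ExZ Ex_exchange -ExZ; apply: eq_Ex => z; rewrite ExZ.
have /eqP -> : Ex (fun x => (agree N (g x) z)%:R) == (2 ^ #|N|)%:R^-1 :> F.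
  by rewrite Ex_agree_eqE.
by rewrite mulrCA mulfV ?two_expn_neq0 ?mulr1.
Qed.

(** [p] is a function of the pattern on [A], and every pattern has probability [2 ^ -|A|]; the
    numerator counts the accepted patterns, coded as subsets of [A]. *)
Lemma dep_granular (F : numFieldType) m (A : {set 'I_m}) (p : pred (bits m)) :
  dep A p -> exists k : nat, Ex (fun x => (p x)%:R) = k%:R / (2 ^ #|A|)%:R :> F.
Proof.
move=> dp.
pose rho (B : {set 'I_m}) : bits m := [ffun i => i \in B].
exists (\sum_(B in powerset A) p (rho B))%N.
rewrite natr_sum mulr_suml.
under [RHS]eq_bigr => B _ do rewrite -(Ex_agree F A (rho B)) -ExZ.
rewrite -Ex_sum; apply: eq_Ex => x.
pose X := [set i in A | x i].
have Xx : agree A (rho X) x by apply/'forall_in_eqP => i iA; rewrite ffunE inE iA.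
rewrite (bigD1 X) /=; last by rewrite powersetE; apply/subsetP => i; rewrite inE => /andP[].
rewrite Xx mulr1 (agree_dep dp Xx) big1 ?addr0 // => B /andP[].
rewrite powersetE => /subsetP BA BX; case: (boolP (agree A (rho B) x)); rewrite ?mulr0 //.
move=> /'forall_in_eqP e; case/eqP: BX; apply/setP => i; rewrite inE.
case: (boolP (i \in A)) => [/e|/(contraNF (BA i))//]; rewrite ffunE => ->; by [].
Qed.

(** * Overlap with the uniform law when many blocks are biased *)

Lemma prod_le_expr (R : numDomainType) (I : eqType) (s : seq I) (a : I -> R) (b : R) :
  {in s, forall i, 0 <= a i <= b} -> \prod_(i <- s) a i <= b ^+ size s.
Proof.
elim: s => [|i s IH] ab; first by rewrite big_nil.
have /andP[a0 aleb] := ab i (mem_head i s).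
have ab' : {in s, forall j, 0 <= a j <= b} by move=> j js; apply: ab; rewrite inE js orbT.
rewrite big_cons exprS ler_pM //; last exact: IH.
by rewrite big_seq prodr_ge0 // => j /ab'/andP[].
Qed.

(** A weighted arithmetic-geometric mean inequality, from [l + l^-1 >= 2]. In the application [l] is
    a tilt that varies with the output. *)
Lemma min_le_amgm (R : realFieldType) (p u l : R) :
  0 <= p -> 0 <= u -> 0 < l -> Num.min p u <= (l * p + l^-1 * u) / 2.
Proof.
move=> p0 u0 l0; set mu := Num.min p u.
have mu0 : 0 <= mu by rewrite le_min p0.
have mp : mu <= p by rewrite ge_min lexx.
have mul : mu <= u by rewrite ge_min lexx orbT.
have h1 : l * mu <= l * p by rewrite ler_wpM2l // ltW.
have h2 : l^-1 * mu <= l^-1 * u by rewrite ler_wpM2l // invr_ge0 ltW.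
have h3 : 2 <= l + l^-1.
  have -> : l + l^-1 = 2 + (l - 1) ^+ 2 / l by field; rewrite gt_eqF.
  by rewrite lerDl divr_ge0 ?sqr_ge0 ?ltW.
have h4 : 2 * mu <= (l + l^-1) * mu by rewrite ler_wpM2r.
rewrite mulrDl in h4; lra.
Qed.

(** Over the common denominator [2 ^ s] the numerators are distinct integers. *)
Lemma granular_gap (R : realFieldType) (a b s k : nat) (p u : R) :
  (a <= s)%N -> (b <= s)%N -> p = k%:R / (2 ^ a)%:R -> u = (2 ^ b)%:R^-1 ->
  p != u -> (2 ^ (2 * s))%:R^-1 <= (p - u) ^+ 2.
Proof.
move=> las lbs -> ->; set p' := _ / _; set u' := _^-1 => ne.
have e1 : p' = (k * 2 ^ (s - a))%:R / (2 ^ s)%:R.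
  have -> : (2 ^ s)%:R = (2 ^ a)%:R * (2 ^ (s - a))%:R :> R.
    by rewrite -natrM -expnD subnKC.
  by rewrite /p' natrM -mulf_div divff ?two_expn_neq0 ?mulr1.
have e2 : u' = (2 ^ (s - b))%:R / (2 ^ s)%:R.
  have -> : (2 ^ s)%:R = (2 ^ b)%:R * (2 ^ (s - b))%:R :> R.
    by rewrite -natrM -expnD subnKC.
  by rewrite /u' invfM mulrCA divff ?two_expn_neq0 ?mulr1.
move: ne; rewrite e1 e2; set x := (k * _)%N; set y := (2 ^ (s - b))%N => ne.
rewrite -mulrBl exprMn exprVn -natrX -expnM mulnC.
rewrite -[leLHS]mul1r ler_wpM2r ?invr_ge0 ?ler0n //.
have nxy : x != y by apply: contraNneq ne => ->.
rewrite !pmulrn -mulrzBr -rmorphXn /= -[1]/(1%:~R) ler_int.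
have : (x%:Z - y%:Z) != 0 by rewrite subr_eq0 eqz_nat.
nia.
Qed.

(** For an event of probability [p] under one law and [u] under another, the tilt is affine in its
    indicator, with slope proportional to the gap and center at the midpoint. The linear terms lower
    both means by [(p - u) ^ 2 / 16]; inverting the tilt costs [2 * th ^ 2], which takes back half
    of this in the second. *)
Lemma overlap_factors (R : realFieldType) (p u e : R) :
  0 <= p <= 1 -> 0 <= u <= 1 -> 0 <= e <= 1 -> e <= (p - u) ^+ 2 ->
  let th := (p - u) / 8 in let c := (p + u) / 2 in
  [/\ 0 <= 1 - th * (p - c) <= 1 - e / 32,
      1 + th * (u - c) + 2 * th ^+ 2 <= 1 - e / 32 &
      forall b : bool, 0 < 1 - th * (b%:R - c) /\
        (1 - th * (b%:R - c))^-1 <= 1 + th * (b%:R - c) + 2 * th ^+ 2].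
Proof.
move=> /andP[p0 p1] /andP[u0 u1] /andP[e0 e1] he th c.
have tp : th * (p - c) = (p - u) ^+ 2 / 16 by rewrite /th /c; field.
have tu : th * (u - c) = - (p - u) ^+ 2 / 16 by rewrite /th /c; field.
have tt : th ^+ 2 = (p - u) ^+ 2 / 64 by rewrite /th; field.
have hq : (p - u) ^+ 2 <= 1 by nra.
split; [by rewrite tp; lra | by rewrite tu tt; lra |].
move=> b; have /andP[b0 b1] : 0 <= (b%:R : R) <= 1 by case: b; rewrite lexx ler01.
set v := b%:R - c.
have v1 : -1 <= v <= 1 by rewrite /v /c; apply/andP; split; lra.
have t1 : -1/8 <= th <= 1/8 by rewrite /th; apply/andP; split; lra.
have w1 : -1/8 <= th * v <= 1/8 by apply/andP; split; nra.
have pos : 0 < 1 - th * v by lra.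
split=> //.
rewrite -[leLHS]mul1r ler_pdivrMr //.
have w2 : (th * v) ^+ 2 <= th ^+ 2.
  rewrite exprMn -[leRHS]mulr1 ler_wpM2l ?sqr_ge0 //; nra.
set w := th * v in w1 w2 pos *.
have := sqr_ge0 th; nra.
Qed.

(** The tilt [L] has one factor per block. Its mean under [g] factors because the sets [K j] are
    disjoint, and the mean of its inverse under uniform outputs because the sets [N j] are. *)
Lemma nonuniform_overlap (R : realFieldType) m n (g : bits m -> bits n)
    (M : seq 'I_n) (N : 'I_n -> {set 'I_n}) (K : 'I_n -> {set 'I_m}) s :
  uniq M ->
  {in M, forall j u, u \in N j -> dep (K j) (fun x => g x u)} ->
  {in M &, forall i j, i != j -> [disjoint K i & K j]} ->
  {in M &, forall i j, i != j -> [disjoint N i & N j]} ->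
  {in M, forall j, #|K j| <= s /\ #|N j| <= s}%N ->
  {in M, forall j, ~~ unif_on (N j) g} ->
  \sum_y Num.min (Ex (fun x => (g x == y)%:R)) (2 ^ n)%:R^-1
    <= (1 - (2 ^ (2 * s))%:R^-1 / 32) ^+ size M :> R.
Proof.
move=> uM dg dK dN cKN nu.
pose bad j (y : bits n) : bool := 
  (#|[set x | agree (N j) (g x) y]| * 2 ^ #|N j| != 2 ^ m)%N.
(* A pattern witnessing that the marginal on [N j] is not uniform; the default value is never met
   for [j] in [M]. *)
pose z j := odflt [ffun=> false] [pick y | bad j y].
have hz : {in M, forall j, bad j (z j)}.
  move=> j /nu; rewrite negb_forall => /existsP[y By]; rewrite /z.
  by case: pickP => // /(_ y); rewrite /bad By.
pose p j : R := Ex (fun x => (agree (N j) (g x) (z j))%:R).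
pose u j : R := (2 ^ #|N j|)%:R^-1.
pose th j := (p j - u j) / 8; pose c j := (p j + u j) / 2.
pose lam j (y : bits n) : R := 1 - th j * ((agree (N j) y (z j))%:R - c j).
pose L y := \prod_(j <- M) lam j y.
pose e : R := (2 ^ (2 * s))%:R^-1.
have e01 : 0 <= e <= 1.
  by rewrite invr_ge0 ler0n invf_le1 ?ltr0n ?ler1n ?expn_gt0.
have dag j : j \in M -> dep (K j) (fun x => agree (N j) (g x) (z j)).
  move=> jM x y exy; apply: eq_forallb => i; case: (boolP (i \in N j)) => //= iN.
  by rewrite (dg j jM i iN x y exy).
have F j : j \in M -> [/\ 0 <= 1 - th j * (p j - c j) <= 1 - e / 32,
      1 + th j * (u j - c j) + 2 * th j ^+ 2 <= 1 - e / 32 &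
      forall b : bool, 0 < 1 - th j * (b%:R - c j) /\
        (1 - th j * (b%:R - c j))^-1 <= 1 + th j * (b%:R - c j) + 2 * th j ^+ 2].
  move=> jM; apply: overlap_factors => //.
  - apply/andP; split; first by apply: Ex_ge0 => x; rewrite ler0n.
    by rewrite -(Ex_cst m 1); apply: ler_Ex => x; rewrite lern1 leq_b1.
  - by rewrite /u invr_ge0 ler0n invf_le1 ?ltr0n ?ler1n ?expn_gt0.
  - have [k pk] := dep_granular R (dag j jM).
    have [cK cN] := cKN j jM.
    apply: (granular_gap cK cN pk erefl).
    by rewrite /p /u Ex_agree_eqE; exact: hz.
have L0 y : 0 < L y.
  rewrite /L big_seq; apply: prodr_gt0 => j jM.
  by have [_ _ /(_ (agree (N j) y (z j)))[]] := F j jM.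
have EP : Ex (fun x => L (g x)) <= (1 - e / 32) ^+ size M.
  rewrite (@Ex_indep_prod _ _ _ M K (fun j x => lam j (g x))) //; last first.
    by move=> j jM; apply: (dep_comp (fun b : bool => 1 - th j * (b%:R - c j)) (dag j jM)).
  apply: prod_le_expr => j jM.
  suff -> : Ex (fun x => lam j (g x)) = 1 - th j * (p j - c j) by case: (F j jM).
  rewrite /lam (@eq_Ex _ _ _ (fun x => (1 + th j * c j) + (- th j) * (agree (N j) (g x) (z j))%:R)).
    by rewrite ExD Ex_cst ExZ -/(p j); ring.
  by move=> x; ring.
have EU : Ex (fun y => (L y)^-1) <= (1 - e / 32) ^+ size M.
  have -> : Ex (fun y => (L y)^-1) = Ex (fun y => \prod_(j <- M) (lam j y)^-1).
    by apply: eq_Ex => y; rewrite prodfV.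
  rewrite (@Ex_indep_prod _ _ _ M N) //; last first.
    move=> j jM; apply: (dep_comp (fun b : bool => (1 - th j * (b%:R - c j))^-1)).
    by move=> x y exy; rewrite ![agree _ _ (z j)]agreeC (dep_agree (z j) exy).
  apply: prod_le_expr => j jM; have [_ h1 h2] := F j jM.
  apply/andP; split.
    by apply: Ex_ge0 => y; rewrite invr_ge0 ltW //; case: (h2 (agree (N j) y (z j))).
  apply: le_trans h1.
  apply: le_trans (ler_Ex (h := fun y => 1 + th j * ((agree (N j) y (z j))%:R - c j) + 2 * th j ^+ 2) _) _.
    by move=> y; case: (h2 (agree (N j) y (z j))).
  rewrite (@eq_Ex _ _ _ (fun y => (1 - th j * c j + 2 * th j ^+ 2) + th j * (agree (N j) (z j) y)%:R)).
    by rewrite ExD Ex_cst ExZ Ex_agree -/(u j) le_eqVlt; apply/orP; left; apply/eqP; ring.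
  by move=> y; rewrite agreeC; ring.
(* Summed over [y], the two halves become the means bounded by [EP] and [EU]. *)
have h y : Num.min (Ex (fun x => (g x == y)%:R)) (2 ^ n)%:R^-1 <=
   2^-1 * (L y * Ex (fun x => (g x == y)%:R)) + 2^-1 * ((L y)^-1 / (2 ^ n)%:R).
  apply: le_trans (min_le_amgm _ _ (L0 y)) _.
  - by apply: Ex_ge0 => x; rewrite ler0n.
  - by rewrite invr_ge0 ler0n.
  - by rewrite mulrC mulrDr.
apply: le_trans (ler_sum _ (fun y _ => h y)) _.
rewrite big_split /= -!mulr_sumr -[X in _ + _ * X]mulr_suml -/(Ex (fun y => (L y)^-1)).
suff -> : \sum_y L y * Ex (fun x => (g x == y)%:R) = Ex (fun x => L (g x)) by lra.
under eq_bigr => y _ do rewrite -ExZ.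
rewrite -Ex_sum; apply: eq_Ex => x.
rewrite (bigD1 (g x)) //= eqxx mulr1 big1 ?addr0 // => y /negPf ne.
by rewrite eq_sym ne mulr0.
Qed.

(** * Decay of characters by resampling the inputs of the centers *)

(** By the triangle inequality [z ^ k] is within [k * |1 - z|] of 1. The powers of [z] sum to 0, so
    the terms [1 - z ^ k] sum to [q], while the [k < q] sum to at most [q ^ 2 / 2]. *)
Lemma root_of_unity_gap (C : numFieldType) (q : nat) (z : C) :
  (0 < q)%N -> z ^+ q = 1 -> z != 1 -> 2 / q%:R <= `|1 - z|.
Proof.
move=> q0 zq z1.
have nz : `|z| = 1.
  by apply/eqP; rewrite -(pexpr_eq1 (n := q)) // -normrX zq normr1.
have h k : `|1 - z ^+ k| <= k%:R * `|1 - z|.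
  elim: k => [|k IH]; first by rewrite expr0 subrr normr0 mul0r.
  have -> : 1 - z ^+ k.+1 = (1 - z) + z * (1 - z ^+ k) by rewrite exprS; ring.
  rewrite (le_trans (ler_normD _ _)) // normrM nz mul1r -natr1 mulrDl mul1r addrC.
  by rewrite lerD2r.
have s0 : \sum_(k < q) z ^+ k = 0.
  have /eqP := subrX1 z q; rewrite zq subrr eq_sym mulf_eq0 subr_eq0 (negPf z1).
  by move=> /eqP.
have hq : q%:R = `|\sum_(k < q) (1 - z ^+ k)|.
  by rewrite sumrB s0 subr0 sumr_const card_ord normr_nat.
have sk : (2 * (\sum_(k < q) k) <= q * q)%N.
  elim: (q) => [|p IH]; first by rewrite big_ord0.
  rewrite big_ord_recr /= mulnDr; move: IH; move: (\sum_(_ < p) _)%N => S; nia.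
have : 2 * q%:R <= (q * q)%:R * `|1 - z|.
  apply: (@le_trans _ _ ((2 * (\sum_(k < q) k))%:R * `|1 - z|)); last first.
    by rewrite ler_wpM2r // ler_nat.
  rewrite natrM -mulrA ler_wpM2l ?ler0n // hq natr_sum mulr_suml.
  by apply: le_trans (ler_norm_sum _ _ _) _; apply: ler_sum.
have q0' : 0 < q%:R :> C by rewrite ltr0n.
move=> h2; rewrite ler_pdivrMr // -(ler_pM2r q0') (le_trans h2) //.
by rewrite le_eqVlt; apply/orP; left; apply/eqP; rewrite natrM; ring.
Qed.

(* Twice the variance is the mean of [|a y - a y'|^2] over independent [y], [y']; for
   unit vectors it is [2 - 2 |E a|^2 <= 4 (1 - |E a|)]. *)
Lemma norm_Ex_unit_le (C : numClosedFieldType) m (A : {set 'I_m}) (a : bits m -> C)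
    (y0 y1 : bits m) (D : C) :
  dep A a -> (forall y, `|a y| = 1) -> 0 <= D -> D <= `|a y0 - a y1| ^+ 2 ->
  `|Ex a| <= 1 - D / 4 / (2 ^ (2 * #|A|))%:R.
Proof.
move=> da na D0 Dle; set mu := Ex a.
have nC y : a y * (a y)^* = 1 by rewrite -normCK na expr1n.
have cE : Ex (fun y => (a y)^*) = mu^*.
  by rewrite /mu /Ex rmorphM /= rmorph_sum fmorphV /= rmorph_nat.
have var : Ex (fun y => Ex (fun y' => `|a y - a y'| ^+ 2)) = 2 - 2 * `|mu| ^+ 2.
  have e y : Ex (fun y' => `|a y - a y'| ^+ 2) = 2 + (- a y * mu^* + (- (a y)^*) * mu).
    rewrite (@eq_Ex _ _ _ (fun y' => 2 + (- a y * (a y')^* + (- (a y)^*) * a y'))).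
      by rewrite !ExD Ex_cst !ExZ cE.
    move=> y'; rewrite normCK rmorphB /= mulrBr !mulrBl nC nC; ring.
  rewrite (eq_Ex e) ExD Ex_cst ExD !ExZr.
  rewrite (@eq_Ex _ _ (fun y => - a y) (fun y => -1 * a y)); last by move=> y; rewrite mulN1r.
  rewrite (@eq_Ex _ _ (fun y => - (a y)^*) (fun y => -1 * (a y)^*)); last by move=> y; rewrite mulN1r.
  by rewrite !ExZ cE normCK -/mu; ring.
have low : D / (2 ^ (2 * #|A|))%:R <= 2 - 2 * `|mu| ^+ 2.
  rewrite -var.
  have -> : D / (2 ^ (2 * #|A|))%:R =
      Ex (fun y => Ex (fun y' => D * (agree A y0 y)%:R * (agree A y1 y')%:R)).
    under eq_Ex => y do rewrite ExZ Ex_agree.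
    by rewrite ExZr ExZ Ex_agree mul2n -addnn expnD natrM invfM mulrA.
  apply: ler_Ex => y; apply: ler_Ex => y'.
  case: (boolP (agree A y0 y)) => [e0|_]; last by rewrite mulr0 mul0r exprn_ge0.
  case: (boolP (agree A y1 y')) => [e1|_]; last by rewrite mulr0 exprn_ge0.
  by rewrite !mulr1 -(agree_dep da e0) -(agree_dep da e1).
have sq : 0 <= (1 - `|mu|) ^+ 2.
  by rewrite real_exprn_even_ge0 // rpredB ?rpred1 ?normr_real.
have -> : D / 4 / (2 ^ (2 * #|A|))%:R = (D / (2 ^ (2 * #|A|))%:R) / 4 by rewrite mulrAC.
rewrite lerBrDr -lerBrDl ler_pdivrMr ?ltr0n //.
apply: le_trans low _; rewrite -subr_ge0.
have -> : (1 - `|mu|) * 4 - (2 - 2 * `|mu| ^+ 2) = 2 * (1 - `|mu|) ^+ 2 by ring.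
by rewrite mulr_ge0 ?ler0n.
Qed.

(** Among the factors only [Phi i] may read [J i], so resampling [J i] replaces [Phi i] by its mean.
    In the induction this mean joins [R0]; it does not read the remaining sets [J j] either. *)
Lemma Ex_resample_prod (F : numFieldType) m (I : eqType) (s : seq I)
    (J : I -> {set 'I_m}) (Phi : I -> bits m -> F) (R0 : bits m -> F) :
  uniq s -> {in s &, forall i j, i != j -> dep (~: J i) (Phi j)} ->
  {in s, forall i, dep (~: J i) R0} ->
  Ex (fun x => R0 x * \prod_(i <- s) Phi i x) =
  Ex (fun x => R0 x * \prod_(i <- s) Ex (fun y => Phi i (mix (J i) y x))).
Proof.
elim: s R0 => [|i s IH] R0 /=.
  by move=> _ _ _; apply: eq_Ex => x; rewrite !big_nil.
case/andP=> iNs us dPhi dR.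
have ne j : j \in s -> i != j by move=> js; apply: contraNneq iNs => ->.
have ins j : j \in s -> j \in i :: s by rewrite inE orbC => ->.
have i0 := mem_head i s.
rewrite -(Ex_mix (J i)) Ex_exchange.
have dis : [disjoint ~: J i & J i] by rewrite -setI_eq0 setIC setICr.
transitivity (Ex (fun x => (R0 x * Ex (fun y => Phi i (mix (J i) y x))) *
    \prod_(j <- s) Phi j x)).
  apply: eq_Ex => x; rewrite -ExZ -ExZr; apply: eq_Ex => y.
  rewrite big_cons (dep_mixr _ _ (dR i i0) dis) mulrA; congr (_ * _).
  by apply: eq_big_seq => j js; apply: (dep_mixr _ _ (dPhi i j i0 (ins j js) (ne j js)) dis).
rewrite (IH (fun x => R0 x * Ex (fun y => Phi i (mix (J i) y x)))) //.
- by apply: eq_Ex => x; rewrite big_cons mulrA.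
- by move=> j k js ks; apply: dPhi; apply: ins.
- move=> j js; apply: (dep2 *%R); first by apply: dR; apply: ins.
  have dj : dep (~: J j) (Phi i) by apply: dPhi; [exact: ins | exact: i0 | rewrite eq_sym ne].
  exact: dep_sub (dep_Ex_mix (A := J i) dj) (subsetDl _ _).
Qed.

(** After resampling, [R0] is bounded by 1 and the moduli of the inner means are independent, since
    they depend on disjoint sets. *)
Lemma norm_Ex_resample_le (F : numFieldType) m (I : eqType) (s : seq I)
    (K J : I -> {set 'I_m}) (Phi : I -> bits m -> F) (R0 : bits m -> F) :
  uniq s -> {in s, forall i, dep (K i) (Phi i)} -> {in s, forall i, J i \subset K i} ->
  {in s &, forall i j, i != j -> [disjoint K i & K j]} ->
  {in s, forall i, dep (~: J i) R0} -> (forall x, `|R0 x| <= 1) ->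
  `|Ex (fun x => R0 x * \prod_(i <- s) Phi i x)| <=
  \prod_(i <- s) Ex (fun x => `|Ex (fun y => Phi i (mix (J i) y x))|).
Proof.
move=> us dPhi sJK dK dR R1; rewrite (Ex_resample_prod us _ dR); last first.
  move=> i j i_s js ij; apply: (dep_sub (dPhi j js)).
  rewrite subsetC -disjoints_subset.
  exact: disjointWl (sJK i i_s) (dK _ _ i_s js ij).
apply: le_trans (norm_Ex_le _) _.
rewrite -(Ex_indep_prod us _ dK); last first.
  move=> i i_s; apply: (dep_comp (fun t => `|t|)).
  exact: dep_sub (dep_Ex_mix (A := J i) (dPhi i i_s)) (subsetDl _ _).
apply: ler_Ex => x; rewrite normrM normr_prod ler_piMl //.
by apply: prodr_ge0.
Qed.

Lemma Ex_sign_coord (F : numFieldType) n (j : 'I_n) (y : bits n -> F) :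
  (forall v, y v = (-1) ^+ v j) -> Ex y = 0.
Proof.
move=> ye; pose phi i (b : bool) : F := if i == j then (-1) ^+ b else 1.
rewrite (@eq_Ex _ _ _ (fun v : bits n => \prod_i phi i (v i))).
  by rewrite Ex_prod_coord (bigD1 j) //= /phi eqxx expr1 expr0 addNr !mul0r.
move=> v; rewrite ye (bigD1 j) //= /phi eqxx big1 ?mulr1 // => i /negPf ->.
by [].
Qed.

(* If the inner mean always had modulus 1, the weight on [N] would ignore the bits of
   [J], hence be independent of the sign of output [j]; for uniform outputs the
   corresponding expectation is a product of nonzero factors. *)
Lemma local_char_decay (C : numClosedFieldType) m n q (g : bits m -> bits n)
    (j : 'I_n) (N : {set 'I_n}) (J K : {set 'I_m}) (w : C) s :
  (0 < q)%N -> w ^+ q = 1 -> w ^+ 2 != 1 -> j \in N -> unif_on N g ->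
  dep J (fun x => g x j) -> J \subset K ->
  (forall u, u \in N -> dep K (fun x => g x u)) -> (#|K| <= s)%N ->
  Ex (fun x => `|Ex (fun y => \prod_(u in N) w ^+ g (mix J y x) u)|) <=
    1 - ((2 ^ (3 * s))%:R * (q ^ 2)%:R)^-1.
Proof.
move=> q0 wq w2 jN ug dJ sJK dN cK.
pose Phi x := \prod_(u in N) w ^+ g x u.
have dPhi : dep K Phi.
  by apply: dep_big => u /dN du; apply: (dep_comp (fun b : bool => w ^+ b) du).
have Phiq x : Phi x ^+ q = 1.
  by rewrite -prodrXl big1 // => u _; rewrite -exprM mulnC exprM wq expr1n.
have nPhi x : `|Phi x| = 1.
  by apply/eqP; rewrite -(pexpr_eq1 (n := q)) // -normrX Phiq normr1.
case: (boolP [exists x, exists y0, exists y1, Phi (mix J y0 x) != Phi (mix J y1 x)]).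
  case/existsP => x0 /existsP[y0 /existsP[y1 ne]].
  (* The values of [Phi] are [q]-th roots of unity, so distinct ones are at least [2 / q] apart. The
     mean over [y] costs [2 ^ (2 * #|K|)], and the event that [x] agrees with [x0] on [K] a further
     [2 ^ #|K|]. *)
  pose e : C := (2 / q%:R) ^+ 2 / 4 / (2 ^ (2 * #|K|))%:R.
  have dx y : dep K (fun x => Phi (mix J y x)).
    by move=> x x' exx; apply: dPhi => i iK; rewrite !mixE; case: ifP => // _; apply: exx.
  have h0 : `|Ex (fun y => Phi (mix J y x0))| <= 1 - e.
    apply: (@norm_Ex_unit_le _ _ _ _ y0 y1).
    - by move=> y y' eyy; apply: dPhi => i iK; rewrite !mixE; case: ifP => // _; apply: eyy.
    - by move=> y; apply: nPhi.
    - by rewrite exprn_ge0 // divr_ge0 ?ler0n.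
    - apply: lerXn2r; rewrite ?nnegrE ?divr_ge0 ?ler0n //.
      have P0 : Phi (mix J y0 x0) != 0 by rewrite -normr_eq0 nPhi oner_eq0.
      have -> : Phi (mix J y0 x0) - Phi (mix J y1 x0) =
          (1 - Phi (mix J y1 x0) / Phi (mix J y0 x0)) * Phi (mix J y0 x0).
        by rewrite mulrBl mul1r divfK.
      rewrite normrM nPhi mulr1.
      apply: root_of_unity_gap => //; first by rewrite expr_div_n !Phiq divr1.
      by rewrite -(inj_eq (mulIf P0)) mul1r divfK // eq_sym.
  have e0 : 0 <= e by rewrite /e !divr_ge0 ?ler0n ?exprn_ge0 ?divr_ge0 ?ler0n.
  apply: (@le_trans _ _ (Ex (fun x => 1 - e * (agree K x0 x)%:R))).
    apply: ler_Ex => x; case: (boolP (agree K x0 x)) => [ag|_].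
      rewrite mulr1; apply: le_trans h0; rewrite le_eqVlt; apply/orP; left; apply/eqP.
      by congr (`|_|); apply: eq_Ex => y; rewrite (agree_dep (dx y) ag).
    rewrite mulr0 subr0 (le_trans (norm_Ex_le _)) // -[leRHS](Ex_cst m 1).
    by apply: ler_Ex => y; rewrite -/(Phi (mix J y x)) nPhi.
  rewrite (@eq_Ex _ _ _ (fun x => 1 + (- e) * (agree K x0 x)%:R)); last by move=> x; rewrite mulNr.
  rewrite ExD Ex_cst ExZ Ex_agree lerD2l mulNr lerN2.
  have -> : e / (2 ^ #|K|)%:R = ((2 ^ (3 * #|K|))%:R * (q ^ 2)%:R)^-1.
    rewrite /e (_ : 3 * #|K| = 2 * #|K| + #|K|)%N; last by lia.
    rewrite expnD !natrM.
    field; rewrite !two_expn_neq0 pnatr_eq0 -lt0n q0 //=.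
  rewrite lef_pV2 ?posrE ?mulr_gt0 ?ltr0n ?expn_gt0 ?q0 //.
  by rewrite ler_wpM2r ?ler0n // ler_nat leq_exp2l // leq_mul2l cK.
move=> /existsPn noex; exfalso.
have cst x y0 y1 : Phi (mix J y0 x) = Phi (mix J y1 x).
  by have /existsPn/(_ y0)/existsPn/(_ y1) := noex x; rewrite negbK => /eqP.
have dC : dep (~: J) Phi.
  move=> x y exy.
  have -> : x = mix J x x by apply/ffunP => i; rewrite mixE; case: ifP.
  have -> : y = mix J y x.
    apply/ffunP => i; rewrite mixE; case: ifP => // iJ.
    by rewrite exy // inE iJ.
  exact: cst.
pose b (v : bits n) : C := (-1) ^+ v j.
pose W (v : bits n) : C := \prod_(u in N) w ^+ v u.
have db : dep N b by move=> x y exy; rewrite /b exy.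
have dW : dep N W by apply: dep_big => u uN x y exy; rewrite exy.
have ind : Ex (fun x => b (g x) * Phi x) = Ex (fun x => b (g x)) * Ex Phi.
  apply: (@Ex_indep _ _ J (~: J)) => //; last by rewrite -setI_eq0 setICr.
  exact: (dep_comp (fun t : bool => (-1) ^+ t) dJ).
move/eqP: ind; rewrite (unif_on_Ex ug db) (@Ex_sign_coord _ _ j b) // mul0r.
rewrite (unif_on_Ex (phi := fun v => b v * W v) ug (dep2 _ db dW)).
(* The factors of the mean are [(1 - w) / 2] at [j], [(1 + w) / 2] at the other outputs in [N], and
   1 elsewhere; [w ^ 2 != 1] keeps them all nonzero. *)
pose phi i (t : bool) : C := (if i == j then (-1) ^+ t else 1) * (if i \in N then w ^+ t else 1).
rewrite (@eq_Ex _ _ _ (fun v : bits n => \prod_i phi i (v i))); last first.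
  move=> v; rewrite /phi big_split /= /W [X in _ * X = _]big_mkcond; congr (_ * _).
  rewrite (bigD1 j) //= eqxx big1 ?mulr1 // => u /negPf ->.
  by [].
rewrite Ex_prod_coord; apply/negP/prodf_neq0 => i _.
have n2 : (2 : C) != 0 by rewrite pnatr_eq0.
have wp : 1 + w != 0.
  by apply: contraNneq w2 => h; rewrite (_ : w = -1) ?sqrrN ?expr1n //; apply/eqP; rewrite -addr_eq0 addrC h.
have wm : 1 - w != 0.
  by apply: contraNneq w2 => h; rewrite (_ : w = 1) ?expr1n //; apply/esym/eqP; rewrite -subr_eq0 h.
rewrite mulf_neq0 ?invr_eq0 // /phi; case: (eqVneq i j) => [->|_].
  by rewrite jN !expr1 !expr0 mul1r mulN1r addrC.
by case: ifP; rewrite ?expr1 ?expr0 !mul1r // addrC.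
Qed.

Lemma prod_split_blocks (R : comPzRingType) (T I : finType) (M : seq I)
    (N : I -> {set T}) (a : T -> R) :
  uniq M -> {in M &, forall i j, i != j -> [disjoint N i & N j]} ->
  \prod_u a u = (\prod_(u | all (fun j => u \notin N j) M) a u) *
    \prod_(j <- M) \prod_(u in N j) a u.
Proof.
elim: M => [|j M IH] /=; first by move=> _ _; rewrite big_nil mulr1.
case/andP=> jNM uM dN; rewrite IH //; last first.
  by move=> i k iM kM; apply: dN; rewrite inE ?iM ?kM orbT.
rewrite big_cons mulrA; congr (_ * _).
rewrite (bigID (fun u => u \in N j)) /= mulrC; congr (_ * _).
  by apply: eq_bigl => u; rewrite andbC.
apply: eq_bigl => u; rewrite andbC; case: (boolP (u \in N j)) => //= uN.
apply/allP => k kM; apply/negP => uNk.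
have /pred0P/(_ u) : [disjoint N j & N k].
  apply: dN; rewrite ?mem_head // ?inE ?kM ?orbT //.
  by apply: contraNneq jNM => ->.
by rewrite /= uN uNk.
Qed.

Lemma expr_hw (R : comPzRingType) n (w : R) (y : bits n) :
  w ^+ hw y = \prod_u w ^+ y u.
Proof.
rewrite prodrXr /hw -sum1_card; congr (_ ^+ _).
by rewrite big_mkcond; apply: eq_bigr => i _; rewrite inE; case: (y i).
Qed.

(** The block [N j] contains every output that shares an input with [j], so the product [R0] over
    the outputs outside the blocks ignores the inputs of all centers. Each center then contributes
    one factor from [local_char_decay]. *)
Lemma char_decay (C : numClosedFieldType) m n q (g : bits m -> bits n)
    (M : seq 'I_n) (N : 'I_n -> {set 'I_n}) (J K : 'I_n -> {set 'I_m}) (w : C) s :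
  (0 < q)%N -> w ^+ q = 1 -> w ^+ 2 != 1 -> uniq M ->
  (forall u, dep (J u) (fun x => g x u)) ->
  {in M, forall j, j \in N j} ->
  {in M, forall j u, u \in N j -> J u \subset K j} ->
  {in M, forall j u, u \notin N j -> [disjoint J u & J j]} ->
  {in M &, forall i j, i != j -> [disjoint K i & K j]} ->
  {in M &, forall i j, i != j -> [disjoint N i & N j]} ->
  {in M, forall j, #|K j| <= s}%N ->
  {in M, forall j, unif_on (N j) g} ->
  `|Ex (fun x => w ^+ hw (g x))| <= (1 - ((2 ^ (3 * s))%:R * (q ^ 2)%:R)^-1) ^+ size M.
Proof.
move=> q0 wq w2 uM dJ jN sJK dJJ dK dN cK ug.
pose Phi j x := \prod_(u in N j) w ^+ g x u.
pose R0 x := \prod_(u | all (fun j => u \notin N j) M) w ^+ g x u.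
have nw : `|w| = 1 by apply/eqP; rewrite -(pexpr_eq1 (n := q)) // -normrX wq normr1.
rewrite (@eq_Ex _ _ _ (fun x => R0 x * \prod_(j <- M) Phi j x)); last first.
  by move=> x; rewrite expr_hw (prod_split_blocks _ uM dN).
have dNK j u : j \in M -> u \in N j -> dep (K j) (fun x => g x u).
  by move=> jM uN; apply: (dep_sub (dJ u)); apply: sJK.
apply: le_trans (@norm_Ex_resample_le _ _ _ M K J _ _ uM _ _ dK _ _) _.
- move=> j jM; apply: dep_big => u uN.
  exact: (dep_comp (fun t : bool => w ^+ t) (dNK j u jM uN)).
- by move=> j jM; exact: (sJK j jM j (jN j jM)).
- move=> j jM; apply: dep_big => u /allP/(_ j jM) uN.
  apply: (dep_comp (fun t : bool => w ^+ t)); apply: (dep_sub (dJ u)).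
  by rewrite -disjoints_subset; apply: dJJ.
- move=> x; rewrite normr_prod big1 // => u _.
  by rewrite normrX nw expr1n.
apply: prod_le_expr => j jM; apply/andP; split; first by apply: Ex_ge0.
apply: (local_char_decay (j := j) (K := K j)) => //.
- exact: jN.
- exact: ug.
- exact: sJK (jN j jM).
- by move=> u; apply: dNK.
- exact: cK.
Qed.

(** * Elimination of the inputs of high degree *)

Lemma pigeonhole_sum (p B : nat) (a : nat -> nat) :
  (0 < p)%N -> (\sum_(k < p) a k <= B)%N -> exists2 k, (k < p)%N & (p * a k <= B)%N.
Proof.
move=> p0 le_B; case: (boolP [exists k : 'I_p, p * a k <= B]%N) => [/existsP[k kB]|].
  by exists (val k); [exact: ltn_ord | exact: kB].
rewrite negb_exists => /forallP gtB; exfalso.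
have : (\sum_(k < p) B.+1 <= \sum_(k < p) p * a k)%N.
  by apply: leq_sum => k _; rewrite ltnNge gtB.
rewrite sum_nat_const card_ord -big_distrr /= leq_pmul2l // leqNgt.
by rewrite ltnS le_B.
Qed.

Lemma card_bigcup_le (T I : finType) (A : {set I}) (F : I -> {set T}) (c : nat) :
  {in A, forall i, #|F i| <= c}%N -> (#|\bigcup_(i in A) F i| <= #|A| * c)%N.
Proof.
move=> Fc; rewrite -sum_nat_const.
apply: (@leq_trans (\sum_(i in A) #|F i|)%N); last exact: leq_sum.
elim/big_rec2: _ => [|i b X _ IH]; first by rewrite cards0.
by rewrite (leq_trans (leq_card_setU _ _)) // leq_add2l.
Qed.

Lemma tow2_gt h : (h < tow2 h)%N.
Proof. by elim: h => //= h IH; apply: leq_trans (ltn_expl _ _) => //; rewrite ltnS. Qed.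

Lemma leq_tow2 h k : (h <= k)%N -> (tow2 h <= tow2 k)%N.
Proof.
move=> /subnKC <-; elim: (k - h)%N => [|j IH]; first by rewrite addn0.
by rewrite addnS /= (leq_trans IH) // ltnW // ltn_expl.
Qed.

(** The intervals []D k, D k.+1]] are disjoint; the right-hand side records their union so that the
    induction goes through. *)
Lemma sum_levels (D : nat -> nat) (x p : nat) :
  (forall k, D k <= D k.+1)%N ->
  (\sum_(k < p) (D k < x <= D k.+1) <= (D 0 < x <= D p))%N.
Proof.
move=> mD; elim: p => [|p IH]; first by rewrite big_ord0.
have D0p : (D 0 <= D p)%N by elim: (p) => // k /leq_trans; apply.
rewrite big_ord_recr /=; have := mD p; move: IH.
move: (\sum_(_ < p) _)%N => S; lia.
Qed.

(** A geometric sum cut off at [x] is at most twice its last term. The second bound in [minn], on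
    the whole sum, carries the induction. *)
Lemma sum_dyadic (D x J : nat) :
  (\sum_(j < J) D * 2 ^ j * (D * 2 ^ j < x) <= minn (2 * x) (D * 2 ^ J))%N.
Proof.
elim: J => [|J IH]; first by rewrite big_ord0.
rewrite big_ord_recr /= expnS; move: IH; move: (\sum_(_ < J) _)%N => S.
by case: ltnP; rewrite ?muln1 ?muln0; lia.
Qed.

Definition deg (m n : nat) (I : 'I_n -> {set 'I_m}) (v : 'I_m) : nat :=
  #|[set u | v \in I u]|.

Lemma sum_deg (m n d : nat) (I : 'I_n -> {set 'I_m}) :
  (forall u, #|I u| <= d)%N -> (\sum_v deg I v <= d * n)%N.
Proof.
move=> Id; have -> : (\sum_v deg I v = \sum_u #|I u|)%N.
  rewrite /deg; under eq_bigr => v _ do rewrite -sum1_card big_mkcond.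
  rewrite exchange_big; apply: eq_bigr => u _; rewrite -sum1_card [RHS]big_mkcond.
  by apply: eq_bigr => v _; rewrite inE.
by rewrite mulnC -[n in (n * d)%N]card_ord -sum_nat_const; apply: leq_sum.
Qed.

(** An output has at most [d] inputs, each in at most one level, so it touches at most [d] of the
    [2 * d] levels; on average a level is touched by at most half of the outputs. *)
Lemma sparse_level (m n d : nat) (I : 'I_n -> {set 'I_m}) (D : nat -> nat) :
  (0 < d)%N -> (forall u, #|I u| <= d)%N -> (forall k, D k <= D k.+1)%N ->
  exists2 k, (k < 2 * d)%N &
   (2 * #|[set u | [exists v in I u, D k < deg I v <= D k.+1]]| <= n)%N.
Proof.
move=> d0 Id mD.
have [||k kd hk] := @pigeonhole_sum (2 * d) (d * n)
    (fun k => #|[set u | [exists v in I u, D k < deg I v <= D k.+1]]|)%N.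
- by rewrite muln_gt0.
- apply: (@leq_trans (\sum_(u : 'I_n) d)%N); last by rewrite sum_nat_const card_ord mulnC.
  under eq_bigr => k _ do rewrite -sum1_card big_mkcond.
  rewrite exchange_big; apply: leq_sum => u _; apply: leq_trans (Id u).
  apply: (@leq_trans (\sum_(k < 2 * d) \sum_(v in I u) (D k < deg I v <= D k.+1))%N).
    apply: leq_sum => k _; rewrite inE; case: ifP => // /exists_inP[v vI hv].
    by rewrite (bigD1 v) //= hv leq_addr.
  rewrite exchange_big -sum1_card; apply: leq_sum => v _.
  exact: leq_trans (sum_levels _ _ mD) (leq_b1 _).
- by exists k => //; rewrite -(leq_pmul2l d0) mulnA [(d * 2)%N]mulnC.
Qed.

(** An input counts at each threshold below its degree, weighted by that threshold, in total at most
    twice its degree. Averaging over the thresholds gains the factor [J] that makes the removed set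
    small. *)
Lemma sparse_dyadic (m n d : nat) (I : 'I_n -> {set 'I_m}) (D J : nat) :
  (0 < J)%N -> (forall u, #|I u| <= d)%N ->
  exists2 j, (j < J)%N &
   (J * (D * 2 ^ j * #|[set v | D * 2 ^ j < deg I v]|) <= 2 * (d * n))%N.
Proof.
move=> J0 Id; apply: (pigeonhole_sum J0).
apply: (@leq_trans (2 * \sum_v deg I v)%N); last by rewrite leq_mul2l sum_deg.
rewrite big_distrr /=; under eq_bigr => j _ do rewrite -sum1_card big_distrr big_mkcond /=.
rewrite exchange_big; apply: leq_sum => v _.
apply: (@leq_trans (\sum_(j < J) D * 2 ^ j * (D * 2 ^ j < deg I v))%N).
  by apply: leq_sum => j _; rewrite inE; case: ltnP.
by apply: leq_trans (sum_dyadic _ _ _) _; rewrite geq_minl.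
Qed.

(** The center is added by hand: when [J i] is empty, [i] shares no input with itself. *)
Definition nbr (m n : nat) (J : 'I_n -> {set 'I_m}) (i : 'I_n) : {set 'I_n} :=
  i |: [set u | ~~ [disjoint J u & J i]].

Definition reach (m n : nat) (J : 'I_n -> {set 'I_m}) (i : 'I_n) : {set 'I_m} :=
  \bigcup_(u in nbr J i) J u.

(* A maximal family of low centers with disjoint reach: every other low center collides
   with one of them, and each collides with few. *)
Lemma disjoint_centers (m n d D D' : nat) (J : 'I_n -> {set 'I_m}) (L : {set 'I_n}) :
  (0 < d)%N -> (0 < D')%N -> (forall u, #|J u| <= d)%N -> (forall v, deg J v <= D')%N ->
  {in L, forall i v, v \in J i -> deg J v <= D}%N ->
  let t := (d * D).+1 in
  exists2 M : {set 'I_n}, (#|L| <= #|M| * (2 * d * t ^ 2 * D'))%N &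
  [/\ {in M &, forall i j, i != j -> [disjoint reach J i & reach J j]},
      {in M &, forall i j, i != j -> [disjoint nbr J i & nbr J j]} &
      {in M, forall i, #|nbr J i| <= t /\ #|reach J i| <= t * d}%N].
Proof.
move=> d0 D'0 Jd JD' LD t.
pose P (M : {set 'I_n}) := (M \subset L) &&
  [forall i in M, forall j in M, (i != j) ==> [disjoint reach J i & reach J j]].
have P0 : P set0.
  by rewrite /P sub0set /=; apply/forall_inP => i; rewrite inE.
have [M /maxsetP[/andP[ML /forall_inP dM] maxM] _] := maxset_exists P0.
have dM' : {in M &, forall i j, i != j -> [disjoint reach J i & reach J j]}.
  by move=> i j iM jM; have /forall_inP/(_ j jM)/implyP := dM i iM.
(* The outputs linked to [u] by an input of degree at most [D]. An input shared with a low center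
   [i] has such a degree, so [i] is in [Q u] even if [u] is not low. *)
pose Q (u : 'I_n) := u |: \bigcup_(w in J u :&: [set w | deg J w <= D]%N) [set i | w \in J i].
have cQ u : (#|Q u| <= t)%N.
  rewrite /Q cardsU1 /t -add1n leq_add ?leq_b1 //.
  apply: leq_trans (card_bigcup_le (c := D) _) _.
    by move=> w; rewrite !inE => /andP[_].
  by rewrite leq_mul2r (leq_trans (subset_leq_card (subsetIl _ _)) (Jd u)) orbT.
have nbrQ i u : i \in L -> u \in nbr J i -> (u \in Q i) && (i \in Q u).
  move=> iL; rewrite !inE [i == u]eq_sym; case: eqVneq => //= _ /pred0Pn[w /= /andP[wu wi]].
  by apply/andP; split; apply/bigcupP; exists w; rewrite !inE ?wi ?wu ?(LD i iL w wi).
have cnbr i : i \in L -> (#|nbr J i| <= t)%N.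
  move=> iL; apply: leq_trans (cQ i); apply: subset_leq_card; apply/subsetP => u uN.
  by case/andP: (nbrQ i u iL uN).
have creach i : i \in L -> (#|reach J i| <= t * d)%N.
  move=> iL; apply: leq_trans (card_bigcup_le (c := d) _) _; first by move=> u _.
  by rewrite leq_mul2r cnbr ?orbT.
exists M; last first.
  have inL i : i \in M -> i \in L by apply/subsetP.
  split=> //; last by move=> i /inL iL; split; [apply: cnbr | apply: creach].
  (* A common neighbor that has an input would put it in both reaches; one without inputs is a
     neighbor of itself only. *)
  move=> i j iM jM ij; have /pred0P dK := dM' i j iM jM ij.
  apply/pred0P => u /=; apply/negbTE/negP => /andP[ui uj].
  have key w : w \in J u -> false.
    move=> wu; have := dK w; rewrite /= => <-; apply/andP.
    by split; apply/bigcupP; exists u.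
  have Ju0 k : k != u -> u \notin nbr J k.
    move=> ku; rewrite !inE negb_or eq_sym ku negbK /=.
    by apply/pred0P => w /=; apply/negbTE/negP => /andP[/key].
  case: (eqVneq i u) => [iu|/Ju0]; last by rewrite ui.
  by have := Ju0 j; rewrite -{1}iu eq_sym ij uj => /(_ isT).
(* A superset of the low centers colliding with [j]: from an input in the reach of [j] to one of its
   at most [D'] outputs, then through a low input. Adding [j] itself covers centers with empty
   reach. *)
pose C j := j |: \bigcup_(v in reach J j) \bigcup_(u in [set u | v \in J u]) Q u.
have cC j : j \in M -> (#|C j| <= 2 * d * t ^ 2 * D')%N.
  move=> jM; have jL : j \in L by apply: (subsetP ML).
  have h : (#|C j| <= 1 + (t * d) * (D' * t))%N.
    rewrite /C cardsU1 leq_add ?leq_b1 //.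
    apply: leq_trans (card_bigcup_le (c := (D' * t)%N) _) _.
      move=> v _; apply: leq_trans (card_bigcup_le (c := t) _) _; first by move=> u _.
      by rewrite leq_mul2r JD' orbT.
    by rewrite leq_mul2r creach ?orbT.
  apply: (leq_trans h).
  have -> : (t * d * (D' * t) = d * t ^ 2 * D')%N by ring.
  have -> : (2 * d * t ^ 2 * D' = d * t ^ 2 * D' + d * t ^ 2 * D')%N by ring.
  by rewrite leq_add2r !muln_gt0 d0 D'0.
apply: leq_trans (card_bigcup_le cC); apply: subset_leq_card; apply/subsetP => i iL.
case: (boolP (i \in M)) => [iM|iNM].
  by apply/bigcupP; exists i => //; rewrite !inE eqxx.
have : ~~ P (i |: M).
  apply/negP => Pi; have := maxM _ Pi (subsetUr _ _) => eM.
  by rewrite -eM !inE eqxx in iNM.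
have coll j : j \in M -> ~~ [disjoint reach J i & reach J j] ->
    i \in \bigcup_(j in M) C j.
  move=> jM /pred0Pn[v /= /andP[/bigcupP[u uN vu] vj]].
  apply/bigcupP; exists j => //; rewrite !inE; apply/orP; right.
  apply/bigcupP; exists v => //; apply/bigcupP; exists u; rewrite ?inE //.
  by case/andP: (nbrQ i u iL uN); rewrite /Q !inE.
rewrite /P subUset sub1set iL ML /= negb_forall_in => /exists_inP[a aM].
rewrite negb_forall_in => /exists_inP[b bM]; rewrite negb_imply => /andP[ab nd].
move: aM bM; rewrite !inE => /orP[/eqP ea|aM] /orP[/eqP eb|bM].
- by rewrite ea eb eqxx in ab.
- by apply: (coll b) => //; rewrite -ea.
- by apply: (coll a) => //; rewrite disjoint_sym -eb.
- by rewrite dM' in nd.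
Qed.

(** Used with [s = d ^ 2 * D + d], at most [D ^ 3 + D] when [d <= D]: one exponential of the level
    dominates the block size [s]. *)
Lemma cubic_le_exp2 (D : nat) : (16 <= D)%N -> (4 * (D ^ 3 + D) + 10 <= 2 ^ D)%N.
Proof.
move=> /subnKC <-; elim: (D - 16)%N => [|k IH]; first by rewrite addn0.
rewrite (addnS 16) (expnS 2); apply: leq_trans (leq_mul (leqnn 2) IH).
move: (16 + k)%N (leq_addr k 16) => x x16.
have x2 : (16 * x <= x * x)%N by rewrite leq_mul2r x16 orbT.
have x3 : (16 * (x * x) <= x * (x * x))%N by rewrite leq_mul2r x16 orbT.
have -> : (x.+1 ^ 3 = x * (x * x) + 3 * (x * x) + 3 * x + 1)%N by rewrite -addn1; ring.
have -> : (x ^ 3 = x * (x * x))%N by ring.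
by move: x2 x3; move: (x * (x * x))%N (x * x)%N => a b; lia.
Qed.

Lemma sqr_le_exp2 (s : nat) : (s ^ 2 <= 2 ^ (2 * s))%N.
Proof. by rewrite mulnC expnM leq_exp2r // ltnW // ltn_expl. Qed.

(** The [2 ^ 2 ^ D] thresholds are numerous enough to pay for factors exponential in [s], while
    [D * 2 ^ J], which bounds them, stays below the fourth exponential of [D], the next level. *)
Lemma threshold_arith (D s J : nat) :
  (D <= s)%N -> (4 * s + 10 <= 2 ^ D)%N -> J = (2 ^ 2 ^ D)%N ->
  [/\ 2 ^ (2 * s + 7) * (8 * s ^ 2) <= J,
      2 ^ (3 * s + 7) * (4 * s ^ 2) * (D * 2 ^ J) <= 2 ^ 2 ^ 2 ^ 2 ^ D &
      D * 2 ^ J <= 2 ^ 2 ^ 2 ^ 2 ^ D]%N.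
Proof.
move=> Ds hs eJ; have s2 := sqr_le_exp2 s.
have J1 : (4 * s + 10 <= J)%N by rewrite eJ (leq_trans hs) // ltnW // ltn_expl.
have J2 : (2 ^ (J + J) <= 2 ^ 2 ^ 2 ^ 2 ^ D)%N.
  rewrite leq_exp2l // addnn -mul2n eJ -expnS leq_exp2l //.
  exact: ltn_expl.
have J3 : (2 * (4 * s + 10) <= J)%N.
  apply: (@leq_trans (2 ^ (2 ^ D).-1.+1)%N).
    rewrite expnS leq_mul2l /= (leq_trans hs) // -[X in (X <= _)%N]prednK ?expn_gt0 //.
    exact: ltn_expl.
  by rewrite eJ prednK ?expn_gt0.
have D2 : (D <= 2 ^ s)%N by rewrite (leq_trans Ds) // ltnW // ltn_expl.
split.
- rewrite eJ; apply: (@leq_trans (2 ^ (2 * s + 7) * (2 ^ 3 * 2 ^ (2 * s)))%N).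
    by rewrite leq_mul2l leq_mul2l s2 !orbT.
  by rewrite -!expnD leq_exp2l //; lia.
- apply: leq_trans J2; apply: (@leq_trans (2 ^ (3 * s + 7) * (2 ^ 2 * 2 ^ (2 * s)) * (2 ^ s * 2 ^ J))%N).
    by apply: leq_mul; [rewrite leq_mul2l leq_mul2l s2 !orbT | rewrite leq_mul2r D2 orbT].
  by rewrite -!expnD leq_exp2l //; lia.
- apply: leq_trans J2; apply: (@leq_trans (2 ^ s * 2 ^ J)%N).
    by rewrite leq_mul2r D2 orbT.
  by rewrite -!expnD leq_exp2l //; lia.
Qed.

(* Inputs of degree above the dyadic threshold go into [S]; outputs touching no input of
   degree between [D k] and [D k.+1] then have all their remaining inputs of degree at
   most [D k]. *)
Lemma elimination (m n d : nat) (I : 'I_n -> {set 'I_m}) :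
  (0 < n)%N -> (0 < d)%N -> (forall u, #|I u| <= d)%N ->
  exists (S : {set 'I_m}) (M : {set 'I_n}) (s : nat),
  let J u := I u :\: S in
  [/\ {in M &, forall i j, i != j -> [disjoint reach J i & reach J j]},
      {in M &, forall i j, i != j -> [disjoint nbr J i & nbr J j]},
      {in M, forall i, #|reach J i| <= s /\ #|nbr J i| <= s}%N,
      (2 ^ (2 * s + 7) * #|S| <= #|M|)%N &
      (2 ^ (3 * s + 7) * n <= #|M| * tow2 (18 * d))%N].
Proof.
(* The offset [d + 3] ensures [D k >= d] and [D k >= 16], and the step 4 separates levels by four
   exponentials. The last height is [d + 3 + 8 * d], at most [18 * d]. *)
move=> n0 d0 Id; pose D k := tow2 (d + 3 + 4 * k).
have mD k : (D k <= D k.+1)%N by apply: leq_tow2; rewrite mulnS; lia.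
have [k kd hk] := sparse_level d0 Id mD.
have DS : D k.+1 = (2 ^ 2 ^ 2 ^ 2 ^ D k)%N.
  by rewrite /D mulnS (_ : _ + (4 + _) = (d + 3 + 4 * k).+4)%N //; lia.
have D16 : (16 <= D k)%N by rewrite -[16%N]/(tow2 3) leq_tow2 //; lia.
have dD : (d <= D k)%N by rewrite (leq_trans _ (ltnW (tow2_gt _))) //; lia.
pose t := (d * D k).+1; pose s := (t * d)%N.
have Ds : (D k <= s)%N by rewrite /s /t; nia.
have hs : (4 * s + 10 <= 2 ^ D k)%N.
  apply: leq_trans (cubic_le_exp2 D16); rewrite leq_add2r leq_mul2l /=.
  rewrite /s /t mulSn addnC leq_add // !expnS expn0 muln1 mulnAC mulnA mulnC.
  by rewrite mulnA leq_mul // leq_mul.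
pose Jn := (2 ^ 2 ^ D k)%N.
have [a1 a2 a3] := threshold_arith Ds hs (erefl Jn).
have [|j jJ hj] := @sparse_dyadic m n d I (D k) Jn _ Id; first by rewrite expn_gt0.
pose D' := (D k * 2 ^ j)%N; pose S := [set v | D' < deg I v]%N.
have D'J : (D' <= D k * 2 ^ Jn)%N by rewrite leq_mul2l leq_exp2l // ltnW ?orbT.
have D'0 : (0 < D')%N by rewrite muln_gt0 expn_gt0 (leq_trans _ D16).
pose L := ~: [set u | [exists v in I u, D k < deg I v <= D k.+1]]%N.
pose J u := I u :\: S.
have degJ v : (deg J v <= deg I v)%N.
  by apply/subset_leq_card/subsetP => u; rewrite !inE => /andP[].
have degJS v : v \in S -> deg J v = 0%N.
  move=> vS; apply/eqP; rewrite cards_eq0; apply/eqP/setP => u.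
  by rewrite inE inE vS inE.
have [|v|i|M hL [M1 M2 M3]] := @disjoint_centers m n d (D k) D' J L d0 D'0.
- by move=> u; apply: leq_trans (Id u); rewrite subset_leq_card // subsetDl.
- case: (boolP (v \in S)) => [/degJS -> //|]; rewrite inE -leqNgt; exact: leq_trans.
- rewrite inE inE => /exists_inPn iL v; rewrite inE inE -leqNgt => /andP[vD' vI].
  apply: leq_trans (degJ v) _; have := iL v vI.
  have -> : (deg I v <= D k.+1)%N by rewrite DS (leq_trans vD') // (leq_trans D'J).
  by rewrite andbT -leqNgt.
have n2 : (n <= 2 * #|L|)%N.
  have := cardsC (~: L); rewrite setCK card_ord.
  by move: hk; rewrite -/(~: L) setCK; lia.
exists S, M, s; split=> //.
- by move=> i /M3[h1 h2]; split=> //; apply: (leq_trans h1); rewrite leq_pmulr.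
(* The upper bound on [#|S|] and the lower bound on [#|M|] are both inversely proportional to [D'],
   which cancels; the gain [Jn] remains. *)
- have n4 : (2 * (d * n) <= #|M| * (8 * s ^ 2) * D')%N.
    apply: (@leq_trans (2 * (d * (2 * (#|M| * (2 * d * t ^ 2 * D')))))%N).
      by rewrite !leq_mul2l (leq_trans n2) ?orbT // leq_mul2l hL.
    by rewrite /s leq_eqVlt; apply/orP; left; apply/eqP; ring.
  have hS : (Jn * #|S| <= #|M| * (8 * s ^ 2))%N.
    by rewrite -(leq_pmul2r D'0) (leq_trans _ n4) // (leq_trans _ hj) // mulnAC -mulnA.
  have s0 : (0 < 8 * s ^ 2)%N by rewrite muln_gt0 expn_gt0 /s muln_gt0 d0.
  rewrite -(leq_pmul2r s0); apply: leq_trans hS.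
  by rewrite mulnAC leq_mul2r a1 orbT.
- have n3 : (n <= #|M| * (4 * s ^ 2) * D')%N.
    apply: (leq_trans n2); apply: (@leq_trans (2 * (#|M| * (2 * d * t ^ 2 * D')))%N).
      by rewrite leq_mul2l hL.
    have -> : (2 * (#|M| * (2 * d * t ^ 2 * D')) = #|M| * (4 * (t ^ 2 * d)) * D')%N by ring.
    rewrite leq_mul2r leq_mul2l leq_mul2l /s expnMn leq_mul2l.
    by rewrite (leq_pexp2l (m := d) d0 (isT : 1 <= 2)%N) !orbT.
  apply: (@leq_trans (#|M| * (2 ^ (3 * s + 7) * (4 * s ^ 2) * D'))%N).
    apply: leq_trans (leq_mul (leqnn _) n3) _.
    by rewrite leq_eqVlt; apply/orP; left; apply/eqP; ring.
  rewrite leq_mul2l; apply/orP; right.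
  apply: leq_trans (leq_mul (leqnn _) D'J) _; apply: leq_trans a2 _.
  by rewrite -DS leq_tow2 //; lia.
Qed.

(** * Fourier inversion modulo [q] *)

(** Orthogonality of characters, by a geometric sum; [q - a] stands for [- a] in [nat]. *)
Lemma sum_prim_root_residue (C : fieldType) (q a w : nat) (z : C) :
  (0 < q)%N -> (a < q)%N -> q.-primitive_root z ->
  \sum_(k < q) z ^+ (k * (w + (q - a))) = (q * (w %% q == a))%N%:R.
Proof.
move=> q0 aq prz; set e := (w + (q - a))%N.
have dve : (q %| e)%N = (w %% q == a)%N.
  by rewrite -[X in _ = (_ == X)](modn_small aq) -(eqn_modDr (q - a)) subnKC ?modnn // ltnW.
transitivity (\sum_(k < q) (z ^+ e) ^+ k).
  by apply: eq_bigr => k _; rewrite -exprM mulnC.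
have := subrX1 (z ^+ e) q; rewrite -exprM mulnC exprM (prim_expr_order prz) expr1n subrr.
case: (boolP (w %% q == a)%N) => hw'.
  move: dve; rewrite hw' (prim_order_dvd prz) => /eqP -> _.
  by under eq_bigr => k _ do rewrite expr1n; rewrite sumr_const card_ord muln1.
move/esym/eqP; rewrite mulf_eq0 subr_eq0 -(prim_order_dvd prz) dve (negPf hw') /=.
by rewrite muln0 => /eqP.
Qed.

(** These [k] index the characters with trivial square, which the decay estimate does not cover. *)
Lemma dvdn_double_lt (q k : nat) : (0 < q)%N -> (k < q)%N ->
  (q %| k * 2)%N = (k == 0)%N || (~~ odd q && (k == q./2)).
Proof.
move=> q0 kq; apply/idP/idP.
  case/dvdnP => -[|[|c]]; last by nia.
    by rewrite mul0n => /eqP; rewrite muln_eq0 orbF => ->.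
  rewrite mul1n => e; rewrite -e muln2 odd_double doubleK eqxx orbT //.
case/orP => [/eqP -> |/andP[oq /eqP ->]]; first by rewrite mul0n dvdn0.
by have := odd_double_half q; rewrite (negbTE oq) add0n muln2 => ->.
Qed.

Lemma Ex_real (C : numFieldType) m (g : bits m -> C) :
  (forall x, g x \is Num.real) -> Ex g \is Num.real.
Proof. by move=> gr; rewrite /Ex rpred_div ?rpred_sum ?rpred_nat. Qed.

(** In the inversion formula the trivial character gives 1, the sign character, present for even
    [q], gives [(-1) ^ a * e], and each other one at most [eps] in modulus. *)
Lemma residue_prob_le (C : numClosedFieldType) m n q a (g : bits m -> bits n) (z eps : C) :
  (0 < q)%N -> (a < q)%N -> q.-primitive_root z -> 0 <= eps ->
  (forall w : C, w ^+ q = 1 -> w ^+ 2 != 1 -> `|Ex (fun x => w ^+ hw (g x))| <= eps) ->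
  let e := Ex (fun x => (-1) ^+ hw (g x)) in
  q%:R * Ex (fun x => (hw (g x) %% q == a)%N%:R) <=
    1 + (if odd q then 0 else (-1) ^+ a * e) + q%:R * eps.
Proof.
move=> q0 aq prz eps0 hE; pose e := Ex (fun x => (-1) ^+ hw (g x)) : C; rewrite /= -/e.
pose c k := z ^+ (k * (q - a)) * Ex (fun x => (z ^+ k) ^+ hw (g x)).
have zq := prim_expr_order prz.
have sumc : q%:R * Ex (fun x => (hw (g x) %% q == a)%N%:R) = \sum_(k < q) c k.
  rewrite -ExZ; under [RHS]eq_bigr => k _ do rewrite /c -ExZ.
  rewrite -Ex_sum; apply: eq_Ex => x; rewrite -natrM -(sum_prim_root_residue _ q0 aq prz).
  by apply: eq_bigr => k _; rewrite mulnDr exprD mulrC (exprM z k (hw (g x))).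
have special : \sum_(k < q | (q %| k * 2)%N) c k = 1 + (if odd q then 0 else (-1) ^+ a * e).
  rewrite (bigD1 (Ordinal q0)) //=; congr (_ + _).
    rewrite /c mul0n expr0 mul1r -[RHS](Ex_cst m); apply: eq_Ex => x.
    by rewrite expr1n.
  case: ifP => oq.
    rewrite big1 // => k /andP[]; rewrite dvdn_double_lt // oq orbF => /eqP k0 /negP[].
    exact/eqP/val_inj.
  have hq : (q./2 < q)%N by rewrite ltn_half_double -addnn; lia.
  have q2 : (q = q./2 * 2)%N by rewrite muln2 -[LHS]odd_double_half oq.
  rewrite (bigD1 (Ordinal hq)) /=; last first.
    rewrite -q2 dvdnn /=; apply/negP => /eqP[h0]; move: q0; rewrite q2 h0.
    by [].
  rewrite big1 ?addr0; last first.
    move=> k /andP[/andP[]]; rewrite dvdn_double_lt // oq /= => /orP[/eqP k0 /negP[]|/eqP k2 _ /negP[]].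
      exact/eqP/val_inj.
    exact/eqP/val_inj.
  have zh : z ^+ q./2 = -1.
    have : (z ^+ q./2) ^+ 2 == 1 by rewrite -exprM -q2 zq.
    rewrite sqrf_eq1 -(prim_order_dvd prz) => /orP[/dvdn_leq|/eqP //].
    by move=> h; move: hq; rewrite ltnNge h //; lia.
  rewrite /c exprM zh; congr (_ * _).
  (* For even [q] the exponent [q - a] has the parity of [a]. *)
  by rewrite -[LHS]signr_odd oddB ?(ltnW aq) // oq /= signr_odd.
have rest : `|\sum_(k < q | ~~ (q %| k * 2)%N) c k| <= q%:R * eps.
  apply: le_trans (ler_norm_sum _ _ _) _.
  have -> : q%:R * eps = \sum_(k < q) eps by rewrite sumr_const card_ord mulr_natl.
  rewrite big_mkcond; apply: ler_sum => k _; case: ifP => // nk.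
  have nz : `|z| = 1 by apply/eqP; rewrite -(pexpr_eq1 (n := q)) // -normrX zq normr1.
  rewrite /c normrM normrX nz expr1n mul1r; apply: hE.
    by rewrite -exprM mulnC exprM zq expr1n.
  by rewrite -exprM -(prim_order_dvd prz).
move: rest; have -> : \sum_(k < q | ~~ (q %| k * 2)%N) c k =
  q%:R * Ex (fun x => (hw (g x) %% q == a)%N%:R) - (1 + (if odd q then 0 else (-1) ^+ a * e)).
  rewrite sumc -special [in RHS](bigID (fun k : 'I_q => (q %| k * 2)%N)) /=.
  by rewrite addrC addrK.
(* The remainder is real, so the bound on its modulus bounds it from above. *)
rewrite -lerBlDl; apply: le_trans; apply: real_ler_norm.
have sr k : (-1) ^+ k \is @Num.real C by rewrite rpredX ?rpredN ?rpred1.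
apply: rpredB.
  by apply: rpredM; [exact: realn | apply: Ex_real => x; exact: realn].
apply: rpredD; first exact: rpred1.
case: ifP => _; first exact: rpred0.
by apply: rpredM; [exact: sr | apply: Ex_real => x; exact: sr].
Qed.

Lemma inLamE (R : pzSemiRingType) (q : nat) (Lam : {set 'I_q}) (w : nat) :
  (inLam Lam w)%:R = \sum_(a in Lam) (w %% q == a)%N%:R :> R.
Proof.
case: (boolP (inLam Lam w)) => [/exists_inP[a aL /eqP ea]|].
  rewrite (bigD1 a) //= -ea eqxx big1 ?addr0 // => b /andP[_ ba].
  by case: eqP => // /val_inj eb; rewrite eb eqxx in ba.
rewrite /inLam => /exists_inPn h; rewrite big1 // => a aL.
by have := h a aL; rewrite eq_sym => /negPf ->.
Qed.

(** The main term times [q], kept in [nat] for the transfer between fields. *)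
Definition parity_bound (q : nat) (Lam : {set 'I_q}) : nat :=
  if odd q then #|Lam| else (2 * maxn #|LamEven Lam| #|LamOdd Lam|)%N.

Lemma card_LamEven_Odd (q : nat) (Lam : {set 'I_q}) :
  (#|Lam| = #|LamEven Lam| + #|LamOdd Lam|)%N.
Proof.
rewrite -(cardsID [set i : 'I_q | ~~ odd i] Lam); congr (_ + _)%N; apply: eq_card => i.
  by rewrite !inE.
by rewrite !inE negbK andbC.
Qed.

Lemma sum_sign_Lam (R : pzRingType) (q : nat) (Lam : {set 'I_q}) :
  \sum_(a in Lam) (-1) ^+ a = #|LamEven Lam|%:R - #|LamOdd Lam|%:R :> R.
Proof.
rewrite (bigID (fun a : 'I_q => ~~ odd a)) /=; congr (_ + _).
  rewrite -sum1_card natr_sum; apply: eq_big => [a|a]; rewrite ?inE // => /andP[_].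
  by rewrite -signr_odd => /negbTE ->.
rewrite -sum1_card natr_sum -sumrN; apply: eq_big => [a|a]; rewrite ?inE ?negbK // => /andP[_ oa].
by rewrite -signr_odd oa.
Qed.

(** For even [q] the main terms add up to [E * (1 + e) + O * (1 - e)], with [E] and [O] the numbers
    of even and odd residues. As [e] lies in [[-1, 1]], both weights are nonnegative, with sum 2. *)
Lemma inLam_prob_le (C : numClosedFieldType) m n q (Lam : {set 'I_q}) (g : bits m -> bits n) (z eps : C) :
  (0 < q)%N -> q.-primitive_root z -> 0 <= eps ->
  (forall w : C, w ^+ q = 1 -> w ^+ 2 != 1 -> `|Ex (fun x => w ^+ hw (g x))| <= eps) ->
  Ex (fun x => (inLam Lam (hw (g x)))%:R) <= (parity_bound Lam)%:R / q%:R + q%:R * eps.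
Proof.
move=> q0 prz eps0 hE; pose e : C := Ex (fun x => (-1) ^+ hw (g x)).
have er : e \is Num.real by rewrite Ex_real // => x; rewrite rpredX ?rpredN ?rpred1.
have e1 : `|e| <= 1.
  apply: le_trans (norm_Ex_le _) _; rewrite -[leRHS](Ex_cst m 1); apply: ler_Ex => x.
  by rewrite normrX normrN1 expr1n.
have q0' : 0 < q%:R :> C by rewrite ltr0n.
have LE : (#|Lam| <= q)%N by rewrite -[X in (_ <= X)%N]card_ord max_card.
rewrite -(ler_pM2l q0') mulrDr [q%:R * (_%:R / _)]mulrC divfK ?gt_eqF //.
under eq_Ex => x do rewrite inLamE.
rewrite Ex_sum mulr_sumr.
apply: le_trans (ler_sum _ (fun a (_ : a \in Lam) =>
  residue_prob_le q0 (ltn_ord a) prz eps0 hE)) _.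
rewrite !big_split /= -/e.
have -> : \sum_(a in Lam) q%:R * eps = #|Lam|%:R * (q%:R * eps) by rewrite sumr_const [RHS]mulr_natl.
have -> : \sum_(a in Lam) 1 = #|Lam|%:R :> C by rewrite sumr_const.
rewrite lerD //; last by rewrite ler_wpM2r ?ler_nat // mulr_ge0 ?ler0n.
rewrite /parity_bound; case: ifP => oq; first by rewrite big1_eq addr0.
rewrite -mulr_suml sum_sign_Lam card_LamEven_Odd natrD natrM.
set E := #|_|; set O := #|_|; set M := maxn E O.
have /andP[em ep] : -1 <= e <= 1 by rewrite -real_ler_norml.
have -> : E%:R + O%:R + (E%:R - O%:R) * e = E%:R * (1 + e) + O%:R * (1 - e) by ring.
have -> : 2 * M%:R = M%:R * (1 + e) + M%:R * (1 - e) by ring.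
rewrite lerD // ler_wpM2r ?ler_nat ?leq_maxl ?leq_maxr //.
  by rewrite addrC -lerBlDr sub0r.
by rewrite subr_ge0.
Qed.

(* The bound is a comparison of rationals, so it passes from the algebraic numbers to
   any ordered field. *)
Lemma rational_transfer (F : numFieldType) (c d b q A r : nat) :
  c%:R / d%:R <= b%:R / q%:R + q%:R * (1 - A%:R^-1) ^+ r :> algC ->
  c%:R / d%:R <= b%:R / q%:R + q%:R * (1 - A%:R^-1) ^+ r :> F.
Proof.
pose lhs : rat := c%:R / d%:R; pose rhs : rat := b%:R / q%:R + q%:R * (1 - A%:R^-1) ^+ r.
have eq_lhs (K : numFieldType) : c%:R / d%:R = ratr lhs :> K.
  by rewrite fmorph_div !rmorph_nat.
have eq_rhs (K : numFieldType) : b%:R / q%:R + q%:R * (1 - A%:R^-1) ^+ r = ratr rhs :> K.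
  by rewrite /rhs rmorphD fmorph_div rmorphM rmorphXn rmorphB rmorph1 /= fmorphV !rmorph_nat.
by rewrite !eq_lhs !eq_rhs !ler_rat.
Qed.

Lemma uniform_blocks_prob_le (F : numFieldType) m n q (Lam : {set 'I_q}) (g : bits m -> bits n)
    (J : 'I_n -> {set 'I_m}) (M : seq 'I_n) s :
  (0 < q)%N -> uniq M -> (forall u, dep (J u) (fun x => g x u)) ->
  {in M &, forall i j, i != j -> [disjoint reach J i & reach J j]} ->
  {in M &, forall i j, i != j -> [disjoint nbr J i & nbr J j]} ->
  {in M, forall j, #|reach J j| <= s}%N -> {in M, forall j, unif_on (nbr J j) g} ->
  Ex (fun x => (inLam Lam (hw (g x)))%:R) <=
    (parity_bound Lam)%:R / q%:R + q%:R * (1 - (2 ^ (3 * s) * q ^ 2)%:R^-1) ^+ size M :> F.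
Proof.
move=> q0 uM dJ dR dN cR uN; rewrite Ex_indicator; apply: rational_transfer.
have [z prz] := C_prim_root_exists q0.
rewrite -Ex_indicator; apply: (inLam_prob_le Lam q0 prz).
  rewrite exprn_ge0 // subr_ge0 invf_le1 ?ler1n ?ltr0n muln_gt0 ?expn_gt0 ?q0 //.
move=> w wq w2; rewrite natrM; apply: (char_decay (N := nbr J) (J := J) (K := reach J)) => //.
- by move=> j _; rewrite !inE eqxx.
- by move=> j _ u uj; apply: bigcup_sup.
- by move=> j _ u; rewrite !inE negb_or negbK => /andP[].
Qed.

(** * From overlap to total variation distance *)

Lemma local_dependency m n d (f : bits m -> bits n) :
  local d f -> exists I : 'I_n -> {set 'I_m},
    (forall u, #|I u| <= d)%N /\ forall u, dep (I u) (fun x => f x u).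
Proof.
move=> /fin_all_exists[I hI]; exists I; split=> u; first by case: (hI u).
by move=> x y; case: (hI u) => _; apply.
Qed.

Lemma one_sub_pow_le_expR (R : realType) (x : R) (k : nat) :
  x <= 1 -> (1 - x) ^+ k <= expR (- (k%:R * x)).
Proof.
move=> x1; rewrite -mulrN expRM_natl lerXn2r ?nnegrE ?subr_ge0 ?expR_ge0 //.
exact: expR_ge1Dx.
Qed.

Lemma normB_min (R : realDomainType) (p d : R) :
  `|p - d| = p + d - 2 * Num.min p d.
Proof.
case: (leP p d) => h; first by rewrite distrC ger0_norm ?subr_ge0 //; ring.
by rewrite ger0_norm ?subr_ge0 ?ltW //; ring.
Qed.

Lemma min_addl_le (R : realDomainType) (a b c : R) :
  0 <= a -> 0 <= b -> 0 <= c -> Num.min (a + b) c <= Num.min a c + Num.min b c.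
Proof.
move=> a0 b0 c0.
by case: (leP (a + b) c); case: (leP a c); case: (leP b c); lra.
Qed.

Lemma min_suml_le (R : realDomainType) (I : Type) (r : seq I) (P : pred I) (a : I -> R) c :
  (forall i, 0 <= a i) -> 0 <= c ->
  Num.min (\sum_(i <- r | P i) a i) c <= \sum_(i <- r | P i) Num.min (a i) c.
Proof.
move=> a0 c0; elim: r => [|i r IH]; first by rewrite !big_nil ge_min lexx.
rewrite !big_cons; case: (P i) => //.
apply: le_trans (min_addl_le _ _ _) _; rewrite ?sumr_ge0 //.
by rewrite lerD2l.
Qed.

Lemma pushUE (R : realType) m n (f : bits m -> bits n) (y : bits n) :
  pushU f y = Ex (fun x => (f x == y)%:R) :> R.
Proof. by rewrite Ex_indicator. Qed.

Lemma suppD_gt0 (n q : nat) (Lam : {set 'I_q}) :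
  (q <= n)%N -> Lam != set0 -> (0 < #|suppD n Lam|)%N.
Proof.
move=> qn /set0Pn[a aL]; have an : (a <= n)%N by apply: leq_trans qn; apply: ltnW.
(* The first [a] bits are set, which is possible since [a < q <= n]. *)
pose A := [set widen_ord an i | i : 'I_a].
rewrite card_gt0; apply/set0Pn; exists [ffun i => i \in A]; rewrite inE.
apply/exists_inP; exists a => //; suff -> : hw [ffun i => i \in A] = a by rewrite modn_small.
rewrite /hw -[RHS]card_ord -(card_imset _ (f := widen_ord an)); last first.
  by move=> i j /(congr1 val) /= ?; apply: val_inj.
by apply: eq_card => i; rewrite inE ffunE.
Qed.

(** Both laws have mass 1 and [|p - d| = p + d - 2 * min p d], so the distance is 1 minus the
    overlap. *)
Lemma tvd_ge_overlap (R : realType) m n q (Lam : {set 'I_q}) (f : bits m -> bits n) (B : R) :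
  (0 < #|suppD n Lam|)%N ->
  \sum_y Num.min (pushU f y) (Dq Lam y) <= B -> 1 - B <= tvd (pushU f) (Dq Lam).
Proof.
move=> s0 hB; rewrite /tvd; under eq_bigr => y _ do rewrite normB_min.
rewrite sumrB big_split /= -mulr_sumr.
have -> : \sum_y pushU f y = 1 :> R.
  under eq_bigr => y _ do rewrite pushUE.
  rewrite -Ex_sum -[RHS](Ex_cst m); apply: eq_Ex => x.
  by rewrite (bigD1 (f x)) //= eqxx big1 ?addr0 // => y /negPf; rewrite eq_sym => ->.
have -> : \sum_(y : bits n) Dq Lam y = 1 :> R.
  rewrite /Dq -mulr_suml -big_mkcond sumr_const divff // pnatr_eq0 -lt0n //.
by lra.
Qed.

Definition density (R : realType) (n q : nat) (Lam : {set 'I_q}) : R :=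
  #|suppD n Lam|%:R / (2 ^ n)%:R.

Lemma Dq_ge0 (R : realType) n q (Lam : {set 'I_q}) (y : bits n) : 0 <= Dq Lam y :> R.
Proof. by rewrite /Dq divr_ge0 ?ler0n //; case: ifP. Qed.

(** It trades the target law for the uniform one at the cost of a factor [1 / eta]. *)
Lemma Dq_le (R : realType) n q (Lam : {set 'I_q}) (y : bits n) :
  Dq Lam y <= (2 ^ n)%:R^-1 / density R n Lam.
Proof.
rewrite /density invf_div mulrA mulVf ?two_expn_neq0 // /Dq ler_wpM2r ?invr_ge0 ?ler0n //.
by case: ifP.
Qed.

Lemma parity_boundE (R : realType) q (Lam : {set 'I_q}) :
  (parity_bound Lam)%:R / q%:R =
  (if odd q then #|Lam|%:R / q%:R
   else 2 * (Num.max #|LamEven Lam|%:R #|LamOdd Lam|%:R) / q%:R) :> R.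
Proof. by rewrite /parity_bound; case: ifP => // _; rewrite natrM -natr_max. Qed.

(** The case [d = 0], which offers no degree levels to choose from. The overlap sits on a single
    output of mass at most [2 ^ -n / eta], and [1 / 2 <= 1 - 1 / q ^ 2]. *)
Lemma constant_overlap (R : realType) m n q (Lam : {set 'I_q}) (f : bits m -> bits n) :
  (2 <= q)%N -> (0 < #|suppD n Lam|)%N -> local 0 f ->
  \sum_y Num.min (pushU f y) (Dq Lam y) <=
    expR (- (n%:R / (q ^ 2)%:R)) / density R n Lam.
Proof.
move=> q2 s0 loc.
have cst x y : f x = f y.
  apply/ffunP => i; have [S [S0 hS]] := loc i; apply: hS => j jS.
  by move: S0; rewrite (cardD1 j) jS.
pose x0 : bits m := [ffun=> false].
rewrite (bigD1 (f x0)) //= big1 ?addr0 => [|y yne]; last first.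
  rewrite pushUE (@eq_Ex _ _ _ (fun=> 0)) ?Ex_cst; last first.
    by move=> x; rewrite (cst x x0) eq_sym (negPf yne).
  by apply/min_idPl; apply: Dq_ge0.
apply: (@le_trans _ _ (Dq Lam (f x0))); first by rewrite ge_min lexx orbT.
apply: le_trans (Dq_le _ _ _) _; rewrite ler_wpM2r ?invr_ge0 ?divr_ge0 ?ler0n //.
have q0 : 0 < (q ^ 2)%:R :> R by rewrite ltr0n expn_gt0 (leq_trans _ q2).
have hq : (q ^ 2)%:R^-1 <= 2^-1 :> R.
  by rewrite lef_pV2 ?posrE // ler_nat (leq_trans q2) // -{1}(expn1 q) leq_pexp2l // (leq_trans _ q2).
apply: le_trans (one_sub_pow_le_expR _ _); last by rewrite invf_le1 // ler1n expn_gt0 (leq_trans _ q2).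
rewrite natrX -exprVn lerXn2r ?nnegrE ?invr_ge0 ?ler0n //; last by lra.
by rewrite subr_ge0; lra.
Qed.

(** * Restrictions of the input and the final dichotomy *)

Lemma unif_on_ext m n (N : {set 'I_n}) (g h : bits m -> bits n) :
  g =1 h -> unif_on N g = unif_on N h.
Proof.
move=> e; apply: eq_forallb => z; congr (_ * _ == _)%N; apply: eq_card => x.
by rewrite !inE e.
Qed.

Definition fix_inputs m n (f : bits m -> bits n) (S : {set 'I_m}) (rho : bits m) :=
  fun x => f (mix S rho x).

Lemma fix_inputs_agree m n (f : bits m -> bits n) S rho rho' :
  agree S rho rho' -> fix_inputs f S rho =1 fix_inputs f S rho'.
Proof.
move=> /'forall_in_eqP e x; congr f; apply/ffunP => i; rewrite !mixE.
by case: ifP => // /e.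
Qed.

(* On [good rho] the output is kept as it is; the union bound over restrictions of [rho]
   to [S] is only taken on the others. *)
Lemma overlap_split (R : realType) m n q (Lam : {set 'I_q}) (f : bits m -> bits n)
    (S : {set 'I_m}) (good : pred (bits m)) (a b : R) :
  (0 < #|suppD n Lam|)%N -> dep S good -> 0 <= a -> 0 <= b ->
  (forall rho, ~~ good rho ->
     \sum_y Num.min (Ex (fun x => (fix_inputs f S rho x == y)%:R)) (2 ^ n)%:R^-1 <= a) ->
  (forall rho, good rho ->
     Ex (fun x => (inLam Lam (hw (fix_inputs f S rho x)))%:R) <= b) ->
  \sum_y Num.min (pushU f y) (Dq Lam y) <= (2 ^ #|S|)%:R * a / density R n Lam + b.
Proof.
move=> s0 dgood a0 b0 hbad hgood; set eta := density R n Lam.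
have eta0 : 0 < eta by rewrite divr_gt0 ?ltr0n ?expn_gt0.
have eta1 : 1 <= eta^-1.
  rewrite invf_ge1 // ler_pdivrMr ?ltr0n ?expn_gt0 // mul1r ler_nat.
  by rewrite -card_bits max_card.
(* Restrictions to [S] are coded by the subsets of [S], so there are [2 ^ #|S|] of them. *)
pose ind (A : {set 'I_m}) : bits m := [ffun i => i \in A].
pose PA A (y : bits n) : R := Ex (fun x => (fix_inputs f S (ind A) x == y)%:R).
pose G (y : bits n) : R := Ex (fun x => (good x && inLam Lam (hw (f x)) && (f x == y))%:R).
have PA0 A y : 0 <= PA A y by apply: Ex_ge0 => x; rewrite ler0n.
have G0 y : 0 <= G y by apply: Ex_ge0 => x; rewrite ler0n.
pose bad := [pred A in powerset S | ~~ good (ind A)].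
have restr (x : bits m) : agree S (ind [set i in S | x i]) x.
  by apply/'forall_in_eqP => i iS; rewrite ffunE inE iS.
(* A bad input is charged to its own restriction, a good one to [G]. Off the support [Dq] vanishes,
   which allows [G] to count only outputs in the support. *)
have pt y : Num.min (pushU f y) (Dq Lam y) <=
    \sum_(A | bad A) Num.min (PA A y) (Dq Lam y) + G y.
  case: (boolP (y \in suppD n Lam)) => ys; last first.
    have -> : Dq Lam y = 0 :> R by rewrite /Dq (negPf ys) mul0r.
    apply: (@le_trans _ _ 0); first by rewrite ge_min lexx orbT.
    rewrite addr_ge0 ?sumr_ge0 // => A _; by rewrite le_min PA0 lexx.
  apply: (@le_trans _ _ (Num.min (\sum_(A | bad A) PA A y + G y) (Dq Lam y))).
    rewrite le_min !ge_min lexx orbT andbT; apply/orP; left.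
    rewrite pushUE -Ex_sum -ExD; apply: ler_Ex => x.
    case: (eqVneq (f x) y) => [fxy|_]; last by rewrite addr_ge0 ?sumr_ge0 ?ler0n // => A _; rewrite ler0n.
    rewrite fxy; move: ys; rewrite inE => ->; rewrite !andbT.
    case: (boolP (good x)) => gx; first by rewrite lerDr sumr_ge0.
    rewrite addr0 (bigD1 [set i in S | x i]) /=; last first.
      rewrite powersetE (agree_dep dgood (restr x)) gx andbT.
      by apply/subsetP => i; rewrite inE => /andP[].
    rewrite (fix_inputs_agree _ (restr x)) /fix_inputs.
    have -> : mix S x x = x by apply/ffunP => i; rewrite mixE; case: ifP.
    by rewrite fxy eqxx lerDl sumr_ge0.
  apply: le_trans (min_addl_le _ _ _) _; rewrite ?sumr_ge0 ?Dq_ge0 //.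
  rewrite lerD //; last by rewrite ge_min lexx.
  by apply: min_suml_le => //; apply: Dq_ge0.
apply: le_trans (ler_sum _ (fun y _ => pt y)) _; rewrite big_split /=; apply: lerD.
  rewrite exchange_big /=.
  apply: (@le_trans _ _ (\sum_(A | bad A) a / eta)).
    apply: ler_sum => A /andP[_ /hbad hA].
    apply: (@le_trans _ _ (\sum_y Num.min (PA A y) (2 ^ n)%:R^-1 / eta)).
      apply: ler_sum => y _; rewrite minr_pMl ?invr_ge0 ?(ltW eta0) //.
      rewrite le_min !ge_min ler_peMr //= Dq_le orbT //.
    by rewrite -mulr_suml ler_wpM2r // invr_ge0 ltW.
  rewrite sumr_const -[_ *+ _]mulr_natl mulrA ler_wpM2r ?invr_ge0 ?(ltW eta0) //.
  rewrite ler_wpM2r // ler_nat -card_powerset; apply: subset_leq_card.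
  by apply/subsetP => A /andP[].
rewrite /G -Ex_sum.
rewrite (@eq_Ex _ _ _ (fun x => (good x && inLam Lam (hw (f x)))%:R)); last first.
  move=> x; rewrite (bigD1 (f x)) //= eqxx andbT big1 ?addr0 // => y /negPf.
  by rewrite eq_sym => ->; rewrite andbF.
rewrite -(Ex_mix S) -(Ex_cst m b); apply: ler_Ex => x.
have gm z : good (mix S x z) = good x by apply: dep_mixl dgood _.
case: (boolP (good x)) => gx.
  by apply: le_trans (hgood x gx); apply: ler_Ex => z; rewrite gm gx.
rewrite (@eq_Ex _ _ _ (fun=> 0)) ?Ex_cst // => z.
by rewrite gm (negPf gx).
Qed.

(** [k] is the number of centers of the majority type among [r]. With [a = 2 ^ -s], the first
    product has exponent at least [r * a ^ 2 / 64]; the [2 ^ c] restrictions use up at most half of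
    it, and the other half is at least [n / T]. *)
Lemma elimination_rates (R : realType) (n q r k s c T : nat) :
  (0 < q)%N -> (0 < T)%N ->
  (2 ^ (2 * s + 7) * c <= r)%N -> (2 ^ (3 * s + 7) * n <= r * T)%N ->
  (r <= 2 * k)%N ->
  let X : R := expR (- (n%:R / ((q ^ 2)%:R * T%:R))) in
  (2 ^ c)%:R * (1 - (2 ^ (2 * s))%:R^-1 / 32) ^+ k <= X /\
  (1 - (2 ^ (3 * s) * q ^ 2)%:R^-1) ^+ k <= X.
Proof.
move=> q0 T0 hc hn hk X.
have q2 : (1 : R) <= (q ^ 2)%:R by rewrite ler1n expn_gt0 q0.
have T0' : 0 < T%:R :> R by rewrite ltr0n.
set a : R := (2 ^ s)%:R^-1.
have a0 : 0 < a by rewrite invr_gt0 ltr0n expn_gt0.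
have a1 : a <= 1 by rewrite invf_le1 ?ltr0n ?ler1n ?expn_gt0.
have e2 : (2 ^ (2 * s))%:R^-1 = a ^+ 2 by rewrite mulnC expnM natrX exprVn.
have e3 : (2 ^ (3 * s))%:R^-1 = a ^+ 3 by rewrite mulnC expnM natrX exprVn.
have hk' : r%:R <= 2 * k%:R :> R by rewrite -natrM ler_nat.
have a20 : 0 <= a ^+ 2 by rewrite exprn_ge0 // ltW.
have a30 : 0 <= a ^+ 3 by rewrite exprn_ge0 // ltW.
have e7 : (2 ^ 7)%:R = 128 :> R by [].
have hc' : c%:R <= r%:R * a ^+ 2 / 128 :> R.
  move: hc; rewrite -(ler_nat R) expnD natrM natrM e7 => h.
  have := ler_wpM2r a20 h; rewrite ler_pdivlMr ?ltr0n //.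
  have -> : (2 ^ (2 * s))%:R * 128 * c%:R * a ^+ 2 = (2 ^ (2 * s))%:R * a ^+ 2 * (c%:R * 128) by ring.
  by rewrite -e2 divff ?two_expn_neq0 // mul1r.
have hn' : 128 * (n%:R / T%:R) <= r%:R * a ^+ 3 :> R.
  move: hn; rewrite -(ler_nat R) expnD natrM natrM [(r * T)%:R]natrM e7 => h.
  have := ler_wpM2r a30 h; rewrite mulrA ler_pdivrMr //.
  have -> : (2 ^ (3 * s))%:R * 128 * n%:R * a ^+ 3 = (2 ^ (3 * s))%:R * a ^+ 3 * (128 * n%:R) by ring.
  by rewrite -e3 divff ?two_expn_neq0 // mul1r mulrAC.
have nT0 : 0 <= n%:R / T%:R :> R by rewrite divr_ge0 ?ler0n.
have a32 : a ^+ 3 <= a ^+ 2 by rewrite exprS ler_piMl // exprn_ge0 // ltW.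
have a31 : a ^+ 2 <= 1 by rewrite exprn_ile1 // ltW.
have r0 : 0 <= r%:R :> R by rewrite ler0n.
have ra : r%:R * a ^+ 3 <= r%:R * a ^+ 2 by rewrite ler_wpM2l.
have ka : r%:R * a ^+ 2 <= 2 * k%:R * a ^+ 2 by rewrite ler_wpM2r.
have ka3 : r%:R * a ^+ 3 <= 2 * k%:R * a ^+ 3 by rewrite ler_wpM2r.
have q20 : 0 < (q ^ 2)%:R :> R by apply: lt_le_trans q2.
have Y : n%:R / ((q ^ 2)%:R * T%:R) <= n%:R / T%:R :> R.
  rewrite ler_wpM2l ?ler0n // lef_pV2 ?posrE ?mulr_gt0 //.
  by rewrite ler_peMl // ltW.
split.
  rewrite e2; have h1 : a ^+ 2 / 32 <= 1 by lra.
  have h2 : (2 ^ c)%:R <= expR c%:R :> R.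
    rewrite -[c%:R]mulr1 expRM_natl natrX lerXn2r ?nnegrE ?expR_ge0 //.
    by have := expR_ge1Dx (1 : R); lra.
  apply: le_trans (ler_pM _ _ h2 (one_sub_pow_le_expR k h1)) _; rewrite ?ler0n //.
    by rewrite exprn_ge0 // subr_ge0.
  by rewrite -expRD ler_expR; lra.
have -> : (2 ^ (3 * s) * q ^ 2)%:R^-1 = a ^+ 3 / (q ^ 2)%:R by rewrite natrM invfM e3.
apply: le_trans (one_sub_pow_le_expR _ _) _.
  by rewrite ler_pdivrMr // mul1r; lra.
rewrite ler_expR lerN2 mulrA -[(q ^ 2)%:R * _]mulrC invfM mulrA.
by rewrite ler_wpM2r ?invr_ge0 ?(ltW q20) //; lra.
Qed.

(** A restriction is good when at least half of the centers have uniform neighborhoods; bad ones go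
    to [nonuniform_overlap], good ones to [uniform_blocks_prob_le]. *)
Lemma overlap_le (R : realType) m n q d (Lam : {set 'I_q}) (f : bits m -> bits n) (X : R) :
  (0 < n)%N -> (0 < q)%N -> (0 < d)%N -> (0 < #|suppD n Lam|)%N -> local d f ->
  X = expR (- (n%:R / ((q ^ 2)%:R * (tow2 (18 * d))%:R))) ->
  \sum_y Num.min (pushU f y) (Dq Lam y) <=
    X / density R n Lam + ((parity_bound Lam)%:R / q%:R + q%:R * X).
Proof.
move=> n0 q0 d0 s0 /local_dependency[I [Id dI]] eX.
have [S [M [s [dR dN cRN hS hn]]]] := elimination n0 d0 Id.
set J := fun u => I u :\: S in dR dN cRN.
have dJ rho u : dep (J u) (fun x => fix_inputs f S rho x u).
  move=> x y exy; apply: dI => i iI; rewrite !mixE; case: ifP => // iS.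
  by apply: exy; rewrite inE iS.
pose MG rho := [set j in M | unif_on (nbr J j) (fix_inputs f S rho)].
pose MB rho := [set j in M | ~~ unif_on (nbr J j) (fix_inputs f S rho)].
pose good rho := (#|M| <= 2 * #|MG rho|)%N.
have cM rho : (#|MG rho| + #|MB rho| = #|M|)%N.
  rewrite -(cardsID [set j | unif_on (nbr J j) (fix_inputs f S rho)] M); congr (_ + _)%N.
    by apply: eq_card => j; rewrite !inE.
  by apply: eq_card => j; rewrite !inE andbC.
have T0 : (0 < tow2 (18 * d))%N by apply: leq_trans (tow2_gt _).
(* The overlap allowed to each bad restriction, so that their union costs [X / eta]. *)
pose a : R := X / (2 ^ #|S|)%:R.
have X0 : 0 <= X by rewrite eX expR_ge0.
have -> : X / density R n Lam = (2 ^ #|S|)%:R * a / density R n Lam.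
  by rewrite /a mulrCA divff ?two_expn_neq0 // mulr1.
have sub_in (P : 'I_n -> 'I_n -> Prop) (A : {set 'I_n}) :
    A \subset M -> {in M &, forall i j, P i j} -> {in enum A &, forall i j, P i j}.
  by move=> /subsetP sAM hP i j; rewrite !mem_enum => /sAM iM /sAM jM; apply: hP.
have sG rho : MG rho \subset M by apply/subsetP => j; rewrite inE => /andP[].
have sB rho : MB rho \subset M by apply/subsetP => j; rewrite inE => /andP[].
apply: (overlap_split (S := S) (good := good)) => //.
- move=> x y exy; have ag : agree S x y by apply/'forall_in_eqP.
  have e : MG x = MG y.
    by apply/setP => j; rewrite !inE (unif_on_ext _ (fix_inputs_agree f ag)).
  by rewrite /good e.
- by rewrite divr_ge0 ?ler0n.
- by rewrite addr_ge0 ?divr_ge0 ?mulr_ge0 ?ler0n.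
- move=> rho; rewrite -ltnNge => hB.
  have hk : (#|M| <= 2 * #|MB rho|)%N by have := cM rho; lia.
  have [h _] := elimination_rates R q0 T0 hS hn hk; rewrite -eX in h.
  rewrite /a ler_pdivlMr ?ltr0n ?expn_gt0 // mulrC; apply: le_trans h.
  rewrite ler_wpM2l ?ler0n // [in X in _ <= X]cardE.
  apply: (@nonuniform_overlap _ _ _ _ _ (nbr J) (reach J)).
  + exact: enum_uniq.
  + move=> j; rewrite mem_enum inE => /andP[jM _] u uN.
    by apply: dep_sub (dJ rho u) _; apply: bigcup_sup.
  + exact: sub_in (sB rho) dR.
  + exact: sub_in (sB rho) dN.
  + by move=> j; rewrite mem_enum => /(subsetP (sB rho))/cRN.
  + by move=> j; rewrite mem_enum inE => /andP[].
- move=> rho hG; have [_ h] := elimination_rates R q0 T0 hS hn hG; rewrite -eX in h.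
  apply: le_trans (@uniform_blocks_prob_le R _ _ _ _ _ J (enum (MG rho)) s q0 _ _ _ _ _ _) _.
  + exact: enum_uniq.
  + exact: dJ.
  + exact: sub_in (sG rho) dR.
  + exact: sub_in (sG rho) dN.
  + by move=> j; rewrite mem_enum => /(subsetP (sG rho))/cRN[].
  + by move=> j; rewrite mem_enum inE => /andP[].
  + by rewrite lerD2l ler_wpM2l ?ler0n // -cardE.
Qed.

Set Strict Implicit. Unset Implicit Arguments. Set Printing Implicit Defensive.

Theorem mainTheorem11 (R : realType) (n q m d : nat) (Lam : {set 'I_q})
  (f : bits m -> bits n) :
  (1 <= n)%N -> (3 <= q)%N -> (q <= n)%N -> Lam != set0 ->
  local d f ->
  let eta : R := #|suppD n Lam|%:R / (2 ^ n)%:R in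
  tvd (pushU f) (Dq Lam) >=
    1 - (6 * q)%:R / eta * expR (- (n%:R / ((q ^ 2)%:R * (tow2 (18 * d))%:R)))
      - (if odd q then #|Lam|%:R / q%:R
         else 2 * (Num.max #|LamEven Lam|%:R #|LamOdd Lam|%:R) / q%:R).
Proof.
move=> n1 q3 qn L0 loc; rewrite /=; set X := expR _; rewrite -parity_boundE -/(density R n Lam).
have q0 : (0 < q)%N by apply: leq_trans q3.
have s0 := suppD_gt0 qn L0.
have D0 : 0 < density R n Lam by rewrite divr_gt0 ?ltr0n ?expn_gt0.
have D1 : 1 <= (density R n Lam)^-1.
  rewrite invf_ge1 // ler_pdivrMr ?ltr0n ?expn_gt0 // mul1r ler_nat.
  by rewrite -card_bits max_card.
have X0 : 0 <= X by apply: expR_ge0.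
have q1 : 1 <= q%:R :> R by rewrite ler1n.
rewrite -addrA -opprD; apply: tvd_ge_overlap => //.
rewrite natrM; set v := (density R n Lam)^-1; set b := _ / q%:R.
have b0 : 0 <= b by rewrite divr_ge0 ?ler0n.
have vX : X <= v * X by rewrite ler_peMl.
have vX0 : 0 <= v * X by apply: le_trans vX.
have qvX : v * X <= q%:R * (v * X) by rewrite ler_peMl.
(* For positive [d] the error [v * X + q * X] is at most [2 * q * v * X], within the factor 6. For
   [d = 0], [tow2 0 = 1] turns the constant case into the same [X]. *)
case: (posnP d) => [d0|d0]; last first.
  apply: le_trans (overlap_le n1 q0 d0 s0 loc (erefl X)) _; rewrite -/X -/v -/b.
  have qX : q%:R * X <= q%:R * (v * X) by rewrite ler_wpM2l ?ler0n.
  have -> : 6 * q%:R * v * X = 6 * (q%:R * (v * X)) by ring.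
  by lra.
rewrite d0 in loc; apply: le_trans (constant_overlap R (ltnW q3) s0 loc) _.
have -> : expR (- (n%:R / (q ^ 2)%:R)) = X by rewrite /X d0 muln0 /= mulr1.
rewrite -/v; have -> : 6 * q%:R * v * X = 6 * (q%:R * (v * X)) by ring.
by lra.
Qed.
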